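(* Let $(T,d_T)$ be an $\mathbb{R}$-tree and let $(Y_i)_{i=1}^{\infty}$ be a sequence of independent, identically distributed random variables on a probability space $(\Omega,\Sigma,\mathbb{P})$ with values in $T$. Assume that the support of the push-forward measure $(Y_1)_{\ast}\mathbb{P}$ has bounded (finite) diameter $D$. Then, for any $n\in\mathbb{N}$ (with $n\ge 1$) and any $r>0$, $$\mathbb{P}\Big(\Big\{\omega\in\Omega \;\Big|\; d_T\big(S_n(\omega),\mathbb{E}_{\mathbb{P}}(Y_1)\big)\geq r\Big\}\Big)\leq 4e^{\frac{4}{75}}\,e^{-\frac{nr^2}{150D^2}},$$ where $S_n(\omega)$ denotes the inductive mean value of the points $Y_1(\omega),\dots,Y_n(\omega)$ (in this order).
   Context: A geodesic in a metric space $(X,d_X)$ is a rectifiable curve $\gamma:[0,1]\to X$ whose arclength equals $d_X(\gamma(0),\gamma(1))$ and which is parametrized proportionally to arclength (constant speed). A geodesic space is a metric space in which any two points are joined by a geodesic; it is uniquely geodesic if this geodesic is unique. A CAT(0)-space is a complete geodesic space $X$ such that $d_X(x,\gamma(1/2))^2\leq \frac12 d_X(x,y)^2+\frac12 d_X(x,z)^2-\frac14 d_X(y,z)^2$ for all $x,y,z\in X$ and every geodesic $\gamma:[0,1]\to X$ from $y$ to $z$. CAT(0)-spaces are uniquely geodesic. An $\mathbb{R}$-tree is a complete geodesic space such that the image of every simple path is the image of a geodesic. Every $\mathbb{R}$-tree is a CAT(0)-space. Barycenter and expectation: for a CAT(0)-space $N$, let $\mathcal{P}^2(N)$ be the set of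 Borel probability measures $\nu$ on $N$ with $\int_N d_N(x,y)^2\,d\nu(y)<+\infty$ for some (hence all) $x\in N$. The barycenter $b(\nu)$ of $\nu\in\mathcal{P}^2(N)$ is the unique minimizer of the function $N\ni x\mapsto \int_N d_N(x,y)^2\,d\nu(y)$; it always exists. For a random variable $W:\Omega\to N$ with $W_{\ast}\mathbb{P}\in\mathcal{P}^2(N)$, the expectation is $\mathbb{E}_{\mathbb{P}}(W):=b(W_{\ast}\mathbb{P})$. Inductive mean value: for points $y_1,y_2,\dots$ in a uniquely geodesic space, define $s_1:=y_1$ and, for $n\geq 2$, $s_n:=\gamma(1/n)$, where $\gamma:[0,1]\to X$ is the geodesic from $\gamma(0)=s_{n-1}$ to $\gamma(1)=y_n$. The point $s_n$ is the inductive mean value of $y_1,\dots,y_n$ (it depends on the order of the points in general). *)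

(* Defs.v *)
From HB Require Import structures.
From mathcomp Require Import all_boot all_order all_algebra.
From mathcomp Require Import all_classical all_reals all_analysis.

Set Implicit Arguments.
Unset Strict Implicit.
Unset Printing Implicit Defensive.

Import Order.TTheory GRing.Theory Num.Theory.
Import numFieldNormedType.Exports.

Local Open Scope classical_set_scope.
Local Open Scope ring_scope.

(* [Complete] includes [Pointed], which measurable types require. *)
#[short(type="completeMetricType")]
HB.structure Definition CompleteMetric (K : numDomainType) :=
  { M of Metric K M & Complete M }.

Section geodesics.
Context {R : realType} {T : completeMetricType R}.
Implicit Types (c : R -> T) (a b t : R) (x y : T).

(* Curves on [0, 1] are represented by functions on R whose values outside
   [0, 1] are irrelevant. *)
Definition polygonal_length a b c (s : seq R) : R :=
  let F := c \o nth b (a :: s) in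
  \sum_(0 <= n < size s) mdist (F n) (F n.+1).

Definition arclength a b c : \bar R :=
  ereal_sup [set (polygonal_length a b c s)%:E | s in itv_partition a b].

(* Rectifiability is implied: the arclength is equal to a real number. *)
Definition geodesic c : Prop :=
  [/\ {within `[0, 1], continuous c},
      arclength 0 1 c = (mdist (c 0) (c 1))%:E
    & forall t, t \in `[0, 1] ->
        arclength 0 t c = (t%:E * arclength 0 1 c)%E].

Definition geodesic_between x y c : Prop :=
  [/\ geodesic c, c 0 = x & c 1 = y].

Definition simple_path c : Prop :=
  {within `[0, 1], continuous c} /\ {in `[0, 1] &, injective c}.

(* The point gamma(t) of the geodesic gamma from x to y; meaningful in uniquely
   geodesic spaces. *)
Definition geodesic_point x y t : T :=
  xget x [set p | exists2 c, geodesic_between x y c & p = c t].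

(* [inductive_mean y n] is the inductive mean value s_n of the n points
   y 0, ..., y n.-1; the value at n = 0 is junk. *)
Fixpoint inductive_mean (y : nat -> T) (n : nat) : T :=
  if n is k.+1 then
    if k == 0%N then y 0%N
    else geodesic_point (inductive_mean y k) (y k) (k.+1%:R^-1)
  else y 0%N.

Definition diameter (A : set T) : \bar R :=
  ereal_sup [set (mdist p.1 p.2)%:E | p in A `*` A].

End geodesics.

Definition geodesic_space (R : realType) (T : completeMetricType R) : Prop :=
  forall x y : T, exists c, geodesic_between x y c.

Definition R_tree (R : realType) (T : completeMetricType R) : Prop :=
  geodesic_space T /\
  forall c : R -> T, simple_path c ->
    exists2 g : R -> T, geodesic g & c @` `[0, 1] = g @` `[0, 1].

Definition borel (R : realType) (T : completeMetricType R) : Type :=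
  g_sigma_algebraType (@open T).
HB.instance Definition _ (R : realType) (T : completeMetricType R) :=
  Measurable.on (borel T).

Section borel_measures.
Context {R : realType} {T : completeMetricType R}.
Local Open Scope ereal_scope.

Definition mean_square_distance (nu : {measure set (borel T) -> \bar R})
    (x : T) : \bar R :=
  \int[nu]_(y in [set: borel T]) ((mdist x (y : T) ^+ 2)%R)%:E.

(* The unique minimizer of the mean square distance; meaningful for probability
   measures with finite second moment on CAT(0)-spaces. *)
Definition barycenter (nu : {measure set (borel T) -> \bar R}) : T :=
  xget point [set b | forall x, x != b ->
    mean_square_distance nu b < mean_square_distance nu x].

(* S is the smallest closed set of full measure.  On a non-separable space such
   a set need not exist, and the complement of the union of the null open sets
   need not have full measure. *)
Definition is_support (nu : set (borel T) -> \bar R) (S : set T) : Prop :=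
  [/\ closed S, nu (~` S) = 0
    & forall F : set T, closed F -> nu (~` F) = 0 -> S `<=` F].

End borel_measures.

Section random_variables.
Context {d d' : measure_display} {Omega : measurableType d}
  {E : measurableType d'} {R : realType}.
Variable P : probability Omega R.
Implicit Type Y : nat -> {RV P >-> E}.
Local Open Scope ereal_scope.

Definition independent_RVs Y : Prop :=
  forall (J : seq nat) (A : nat -> set E),
    uniq J -> (forall i, measurable (A i)) ->
    P (\bigcap_(i in [set` J]) (Y i @^-1` A i)) =
    \prod_(i <- J) P (Y i @^-1` A i).

Definition identically_distributed Y : Prop :=
  forall (i j : nat) (A : set E), measurable A ->
    distribution P (Y i) A = distribution P (Y j) A.

End random_variables.

Definition expectation_in (R : realType) (T : completeMetricType R)
    (d : measure_display) (Omega : measurableType d) (P : probability Omega R)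
    (W : {RV P >-> borel T}) : T :=
  barycenter (distribution P W).

(* Main.v *)
Require Import Defs.
From HB Require Import structures.
From mathcomp Require Import all_boot all_order all_algebra.
From mathcomp Require Import all_classical all_reals all_analysis.
From mathcomp Require unstable.
From mathcomp Require Import measurable_realfun.
From mathcomp Require Import ring lra.

(** Let [b] be the barycenter and [X_n = n d(b, S_n)].  The theorem holds
because [X_n] is dominated by a reflected random walk without drift away from
0, and such a walk has Gaussian tails.

The geometry of the tree enters through one inequality.  The nearest point of
a geodesic separates its point of projection from both ends of the geodesic
([nearest_point_additive]), so the distance to a fixed point is bounded along a
geodesic by the maximum of two affine functions of slopes plus and minus the
length ([dist_geodesic_le]).  This gives the CAT(0) inequality at midpoints, the
joint convexity of the distance, hence the Lipschitz bound
[inductive_mean_lipschitz], and the behaviour of one step of the mean: if [y_n]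
lies on the same side of [b] as [S_{n-1}] then [X_n <= X_{n-1} + d(b, y_n)]
([inductive_mean_growth]); otherwise the geodesic from [S_{n-1}] to [y_n]
passes through [b] and [X_n = |X_{n-1} - d(b, y_n)|]
([inductive_mean_reflect]).  In both cases [X_n <= |X_{n-1} + h|], where [h] is
the signed distance from [b] to [y_n] as seen in the direction of [S_{n-1}].

The barycenter minimizes the mean square distance, and the derivative of that
function at [b] in a given direction is [- 2 E h]; so [E h <= 0]
([barycenter_drift_le]).  Moreover [|h| <= D], because the barycenter is at
distance at most [D] from the support ([barycenter_mdist_le]).  From
[e^u <= u + e^(2 u^2)] one gets
[cosh(A + u) <= e^(2 x^2) cosh A + u sinh A] for [|u| <= x], and averaging over
[y_n] gives [E cosh(l X_n) <= e^(2 l^2 D^2) E cosh(l X_{n-1})]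
([coshR_moment_step]).  Markov's inequality for [cosh] with [l = r / (4 D^2)]
bounds the probability by [2 exp(- n r^2 / (8 D^2))], which is better than the
claim; the margin pays for the errors made below.

The space may be non-separable, so [S_n] need not be measurable and product
measures on powers of the space are unsuitable.  But every ball centered in the
support has positive mass, so the support is separable, and up to a small mass
it is covered by finitely many small balls ([finite_net]).  Rounding each
variable to the center of its cell moves [S_n] by at most the radius, turns the
moment into a finite sum over words of cells ([words_moment]), and uses
independence only for the probabilities of finitely many product events
([discretized_tail]).  The side of [b] on which a point lies is not continuous
in the point; it is replaced by comparing a Gromov product with a positive
threshold, at the cost of an error proportional to the threshold. *)

Import Order.TTheory GRing.Theory Num.Theory.
Import numFieldNormedType.Exports.

Local Open Scope classical_set_scope.
Local Open Scope ring_scope.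

Set Implicit Arguments.
Unset Strict Implicit.
Unset Printing Implicit Defensive.

(** * Geodesics have constant speed *)

Section geodesic_speed.
Context {R : realType} {T : completeMetricType R}.
Implicit Types (c : R -> T) (s t u v : R).

Lemma polygonal_length_rcons c a u v (p : seq R) : itv_partition a u p ->
  polygonal_length a v c (rcons p v) =
  polygonal_length a u c p + mdist (c u) (c v).
Proof.
move=> pp; rewrite /polygonal_length size_rcons big_nat_recr//=.
congr (_ + mdist (c _) (c _)).
- apply: eq_big_nat => i /andP[_ ip].
  congr (mdist (c _) (c _)).
    rewrite -rcons_cons nth_rcons /= ltnS ltnW//.
    by apply: set_nth_default; rewrite /= ltnS ltnW.
  by rewrite nth_rcons ip; exact: set_nth_default.
- rewrite -rcons_cons nth_rcons /= ltnSn.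
  exact: (itv_partition_nth_size v pp).
- by rewrite nth_rcons ltnn eqxx.
Qed.

Lemma arclength_le c a u v : u < v ->
  (arclength a u c + (mdist (c u) (c v))%:E <= arclength a v c)%E.
Proof.
move=> uv; rewrite -leeBrDr//; apply: ge_ereal_sup => _ [p pp <-].
rewrite leeBrDr// -EFinD -(polygonal_length_rcons c v pp).
apply: ereal_sup_ubound; exists (rcons p v) => //.
by rewrite -cats1; exact: (itv_partition_cat pp (itv_partition1 uv)).
Qed.

(** The triangle inequality through [c s] and [c t] turns the upper bounds given
by the arclengths of the three pieces into equalities, because their sum is
already the distance of the end points. *)
Lemma geodesic_dist c s t : geodesic c -> s \in `[0, 1] -> t \in `[0, 1] ->
  mdist (c s) (c t) = `|s - t| * mdist (c 0) (c 1).
Proof.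
case=> _ len speed.
have le_len u v : 0 <= u -> u <= v -> v <= 1 ->
    mdist (c u) (c v) <= (v - u) * mdist (c 0) (c 1).
  move=> u0; rewrite le_eqVlt => /predU1P[->|uv] v1.
    by rewrite subrr mul0r mdistxx.
  have spd x : 0 <= x <= 1 -> arclength 0 x c = (x * mdist (c 0) (c 1))%:E.
    by move=> x01; rewrite speed ?in_itv// len EFinM.
  have := arclength_le c 0 uv.
  rewrite !spd; [|by apply/andP; split; lra..].
  by rewrite -EFinD lee_fin mulrBl; lra.
wlog st : s t / s <= t => [hw s01 t01|].
  case: (leP s t) => [|/ltW] st; first exact: hw.
  by rewrite metric_sym distrC; exact: hw.
rewrite !in_itv/= => /andP[s0 s1] /andP[t0 t1].
rewrite distrC ger0_norm ?subr_ge0//; apply/eqP; rewrite eq_le le_len//=.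
have h0 := le_len _ _ (lexx 0) s0 s1.
have h1 := le_len _ _ t0 t1 (lexx 1).
have := metric_triangle (c 0) (c s) (c 1).
have := metric_triangle (c s) (c t) (c 1).
by move: h0 h1; rewrite !mulrBl mul1r mul0r; lra.
Qed.

End geodesic_speed.

(** * Projection onto a geodesic of an R-tree *)

Lemma lipschitz_within_continuous (R : realType) (U : pseudoMetricType R)
    (f : R -> U) (K : R) : 0 < K ->
  (forall s t e, s \in `[0, 1] -> t \in `[0, 1] -> K * `|s - t| < e ->
     ball (f s) e (f t)) ->
  {within `[0, 1], continuous f}.
Proof.
move=> K0 fK; apply/subspace_continuousP => s s01.
apply/cvg_ballP => e e0; rewrite near_withinE.
exists (e / K) => /=; first by rewrite divr_gt0.
by move=> t /= st t01; apply: fK => //; rewrite mulrC -ltr_pdivlMr.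
Qed.

Lemma mdist_reverse_triangle (R : realType) (T : completeMetricType R) (x y z : T) :
  `|mdist x y - mdist x z| <= mdist y z.
Proof.
have := metric_triangle x y z; have := metric_triangle x z y.
rewrite (metric_sym z y) ler_norml => h1 h2; apply/andP; split; lra.
Qed.

Lemma within_continuous_dist (R : realType) (T : completeMetricType R)
    (x : T) (s : R -> T) :
  {within `[0, 1], continuous s} ->
  {within `[0, 1], continuous (fun t => mdist x (s t))}.
Proof.
move=> /subspace_continuousP sC; apply/subspace_continuousP => t t01.
have /cvg_ballP {}sC := sC t t01.
apply/cvg_ballP => e /sC; apply: filterS => u.
rewrite ballEmdist /= => tu.
exact: le_lt_trans (mdist_reverse_triangle _ _ _) tu.
Qed.

(** A continuous injection of a segment is monotone. *)
Lemma segment_injective_additive (R : realType) (f : R -> R) (m : R) :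
  {within `[0, 1], continuous f} -> {in `[0, 1] &, injective f} ->
  0 <= m -> m <= 1 -> `|f 0 - f 1| = `|f 0 - f m| + `|f m - f 1|.
Proof.
move=> fC fI m0 m1.
have i01 : (0 : R) \in `[(0:R), 1] by rewrite in_itv/= lexx ler01.
have i11 : (1 : R) \in `[(0:R), 1] by rewrite in_itv/= lexx ler01.
have m01 : m \in `[(0:R), 1] by rewrite in_itv/= m0.
have [fm|fm] := unstable.strict_monotonicW (itv_continuous_inj_mono fC fI).
- have := fm 0 m i01 m01 m0; have := fm m 1 m01 i11 m1.
  move: (f 0) (f m) (f 1) => x y z yz xy; clear -xy yz.
  have xz := le_trans xy yz.
  by rewrite !ler0_norm ?subr_le0 //; ring.
- have := fm m 0 m01 i01 m0; have := fm 1 m i11 m01 m1.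
  move: (f 0) (f m) (f 1) => x y z zy yx; clear -zy yx.
  have zx := le_trans zy yx.
  by rewrite !ger0_norm ?subr_ge0 //; ring.
Qed.

Section tripod.
Context {R : realType} {T : completeMetricType R}.
Implicit Types (c g : R -> T) (p x y z : T) (s t u v : R).
Hypothesis treeT : R_tree T.

(** The path [s] and a geodesic [g] have the same image, so [s] is isometric to
its image under [f t = d(g 0, s t)].  This [f] is a continuous injection of the
segment into the line, so [f m] lies between [f 0] and [f 1]. *)
Lemma simple_path_additive (s : R -> T) (m : R) : simple_path s ->
  m \in `[0, 1] ->
  mdist (s 0) (s 1) = mdist (s 0) (s m) + mdist (s m) (s 1).
Proof.
move=> ss m01; have [sC sI] := ss; have [g gg sg] := treeT.2 _ ss.
have par (t : R) : t \in `[0, 1] -> exists2 v : R, v \in `[0, 1] & g v = s t.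
  move=> t01; have : (s @` `[0, 1]) (s t) by exists t.
  by rewrite sg => -[v v01 gv]; exists v.
pose f (t : R) : R := mdist (g 0) (s t).
have i01 : (0 : R) \in `[(0:R), 1] by rewrite in_itv/= lexx ler01.
have i11 : (1 : R) \in `[(0:R), 1] by rewrite in_itv/= lexx ler01.
have dist_f : forall t u : R, t \in `[0, 1] -> u \in `[0, 1] ->
    mdist (s t) (s u) = `|f t - f u|.
  move=> t u /par[v v01 gv] /par[w w01 gw]; rewrite /f -gv -gw.
  rewrite (geodesic_dist gg v01 w01) (geodesic_dist gg i01 v01).
  rewrite (geodesic_dist gg i01 w01) !sub0r !normrN -mulrBl normrM.
  have v0 : 0 <= v by move: v01; rewrite in_itv => /andP[].
  have w0 : 0 <= w by move: w01; rewrite in_itv => /andP[].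
  by rewrite (ger0_norm (mdist_ge0 _ _)) (ger0_norm v0) (ger0_norm w0).
have fC := @within_continuous_dist _ _ (g 0) _ sC.
have fI : {in `[0, 1] &, injective f}.
  move=> x y x01 y01 xy; apply: sI => //; apply: mdist_positivity.
  by rewrite (dist_f x y x01 y01) xy subrr normr0.
rewrite (dist_f 0 1 i01 i11) (dist_f 0 m i01 m01) (dist_f m 1 m01 i11).
move: m01; rewrite in_itv => /andP[m0 m1].
exact: (segment_injective_additive fC fI m0 m1).
Qed.

Lemma exists_nearest_point p c : geodesic c ->
  exists2 u : R, 0 <= u <= 1 &
    forall t, 0 <= t <= 1 -> mdist p (c u) <= mdist p (c t).
Proof.
move=> [cC _ _].
have [u u01 umin] := EVT_min ler01 (@within_continuous_dist _ _ p _ cC).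
by exists u => [|t t01]; [move: u01|apply: umin]; rewrite in_itv.
Qed.

Lemma geodesicE c u v : geodesic c -> 0 <= u <= 1 -> 0 <= v <= 1 ->
  mdist (c u) (c v) = `|u - v| * mdist (c 0) (c 1).
Proof. by move=> gc u01 v01; rewrite geodesic_dist // in_itv. Qed.

Definition broken_path g c u v : R -> T := fun t =>
  if t <= 2^-1 then g (2 * t) else c (u + (2 * t - 1) * (v - u)).

Lemma segment_itv u v t : 0 <= u <= 1 -> 0 <= v <= 1 -> 0 <= t <= 1 ->
  0 <= u + t * (v - u) <= 1.
Proof.
move=> /andP[u0 u1] /andP[v0 v1] /andP[t0 t1].
rewrite (_ : u + _ = (1 - t) * u + t * v); last by ring.
apply/andP; split; first by rewrite addr_ge0 ?mulr_ge0 ?subr_ge0.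
rewrite [leRHS](_ : 1 = (1 - t) * 1 + t * 1); last by ring.
by rewrite lerD // ler_wpM2l ?subr_ge0.
Qed.

(** A point common to [g] and [c] is no nearer to [g 0] than [c u], hence it is
the end [c u] of [g]. *)
Lemma broken_path_simple g c u v : geodesic g -> geodesic c ->
    0 <= u <= 1 -> 0 <= v <= 1 ->
    g 1 = c u -> g 0 != c u -> c u != c v ->
    (forall t, 0 <= t <= 1 -> mdist (g 0) (c u) <= mdist (g 0) (c t)) ->
  simple_path (broken_path g c u v).
Proof.
move=> gg gc u01 v01 g1 gu uv near.
set A := mdist (g 0) (c u); set B := mdist (c u) (c v).
have A0 : 0 < A by rewrite mdist_gt0.
have B0 : 0 < B by rewrite mdist_gt0.
have d1 s t : 0 <= s -> s <= t -> t <= 2^-1 ->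
    mdist (broken_path g c u v s) (broken_path g c u v t) = 2 * A * (t - s).
  move=> s0 st t2; rewrite /broken_path t2 (le_trans st t2).
  rewrite geodesicE //; try (apply/andP; split; lra).
  by rewrite g1 -/A ler0_norm; [ring|lra].
have d2 s t : 2^-1 < s -> s <= t -> t <= 1 ->
    mdist (broken_path g c u v s) (broken_path g c u v t) = 2 * B * (t - s).
  move=> s2 st t1; rewrite /broken_path !leNgt (lt_le_trans s2 st) s2 /=.
  rewrite geodesicE //; try (apply: segment_itv => //; apply/andP; split; lra).
  rewrite (_ : _ - _ = (2 * (t - s)) * (u - v)); last by ring.
  rewrite normrM -[LHS]mulrA -(geodesicE gc u01 v01) -/B ger0_norm; first by ring.
  lra.
have mid : broken_path g c u v 2^-1 = c u.
  by rewrite /broken_path lexx divff // g1.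
have d3 s : 2^-1 < s -> s <= 1 ->
    mdist (c u) (broken_path g c u v s) = 2 * B * (s - 2^-1).
  move=> s2 s1; rewrite /broken_path leNgt s2 /=.
  rewrite geodesicE //; last by apply: segment_itv => //; apply/andP; split; lra.
  rewrite (_ : u - _ = (2 * s - 1) * (u - v)); last by ring.
  rewrite normrM -[LHS]mulrA -(geodesicE gc u01 v01) -/B ger0_norm; first by field.
  lra.
have le1 (s t : R) : 0 <= s -> s <= t -> t <= 1 ->
    mdist (broken_path g c u v s) (broken_path g c u v t) <=
    2 * (A + B) * (t - s).
  move=> s0 st t1.
  have AD : 0 <= A * (t - s) by rewrite mulr_ge0 ?subr_ge0 // ltW.
  have BD : 0 <= B * (t - s) by rewrite mulr_ge0 ?subr_ge0 // ltW.
  have [t2|t2] := leP t 2^-1; first by rewrite d1 //; nra.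
  have [s2|s2] := leP s 2^-1; last by rewrite d2 //; nra.
  have := metric_triangle (broken_path g c u v s) (c u) (broken_path g c u v t).
  have := d1 s 2^-1 s0 s2 (lexx _); rewrite mid => ->.
  rewrite d3 // => tri.
  have : 0 <= A * (t - 2^-1) by rewrite mulr_ge0 ?subr_ge0 // ltW.
  have : 0 <= B * (2^-1 - s) by rewrite mulr_ge0 ?subr_ge0 // ltW.
  by move: tri; nra.
split.
  apply: (@lipschitz_within_continuous _ _ _ (2 * (A + B))) => [|s t e].
    by rewrite mulr_gt0 // addr_gt0.
  rewrite !in_itv /= => /andP[s0 s1] /andP[t0 t1] h.
  rewrite ballEmdist /=; apply: le_lt_trans h.
  have [st|/ltW ts] := leP s t.
    by rewrite distrC ger0_norm ?subr_ge0 // le1.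
  by rewrite ger0_norm ?subr_ge0 // metric_sym le1.
suff inj s t : 0 <= s -> s < t -> t <= 1 ->
    broken_path g c u v s <> broken_path g c u v t.
  move=> s t; rewrite !in_itv /= => /andP[s0 s1] /andP[t0 t1] st.
  by case: (ltgtP s t) => // h; [case: (inj s t)|case: (inj t s)].
move=> s0 st t1 e.
have [t2|t2] := leP t 2^-1.
  have := d1 s t s0 (ltW st) t2; rewrite e mdistxx => /esym/eqP.
  by rewrite mulf_eq0 mulf_eq0 pnatr_eq0 (gt_eqF A0) subr_eq0 (gt_eqF st).
have [s2|s2] := leP s 2^-1; last first.
  have := d2 s t s2 (ltW st) t1; rewrite e mdistxx => /esym/eqP.
  by rewrite mulf_eq0 mulf_eq0 pnatr_eq0 (gt_eqF B0) subr_eq0 (gt_eqF st).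
have : A <= mdist (g 0) (broken_path g c u v t).
  rewrite /broken_path (leNgt t) t2 /=; apply: near.
  by apply: segment_itv => //; apply/andP; split; lra.
have b0 : broken_path g c u v 0 = g 0.
  by rewrite /broken_path mulr0 invr_ge0 ler0n.
rewrite -e -b0 d1 // subr0 => As.
have s12 : s = 2^-1.
  by apply/eqP; rewrite eq_le s2 /= leNgt; apply/negP => h; move: As; nra.
have := d3 t t2 t1; rewrite -e s12 mid mdistxx => /esym/eqP.
by rewrite mulf_eq0 mulf_eq0 pnatr_eq0 (gt_eqF B0) subr_eq0 (gt_eqF t2).
Qed.

(** Going from [p] straight to its projection [c u] and then along [c] is a
simple path, and simple paths in an R-tree are additive. *)
Lemma nearest_point_additive p c u v : geodesic c ->
    0 <= u <= 1 -> 0 <= v <= 1 ->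
    (forall t, 0 <= t <= 1 -> mdist p (c u) <= mdist p (c t)) ->
  mdist p (c v) = mdist p (c u) + mdist (c u) (c v).
Proof.
move=> gc u01 v01 near.
have [->|pu] := eqVneq p (c u); first by rewrite mdistxx add0r.
have [<-|uv] := eqVneq (c u) (c v); first by rewrite mdistxx addr0.
have [g [gg g0 g1]] := treeT.1 p (c u).
have half : 0 <= 2^-1 :> R by rewrite invr_ge0.
have half1 : 2^-1 <= 1 :> R by rewrite invf_le1 // ler1n.
have sp : simple_path (broken_path g c u v).
  by apply: broken_path_simple => //; rewrite g0.
have := simple_path_additive (m := 2^-1) sp.
rewrite in_itv /= half half1 => /(_ isT).
rewrite /broken_path mulr0 half lexx divff // g0 g1.
rewrite leNgt invf_lt1 // ltr1n /= (_ : 2 * 1 - 1 = 1); last by ring.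
by rewrite mul1r addrC subrK.
Qed.

(** On either side of the projection of [p] to [c], the distance to [p] is
affine with slope plus or minus the length of [c].  All later uses of the tree
structure go through this inequality. *)
Lemma dist_geodesic_le p c t : geodesic c -> 0 <= t <= 1 ->
  mdist p (c t) <=
  Num.max (mdist p (c 0) - t * mdist (c 0) (c 1))
          (mdist p (c 1) - (1 - t) * mdist (c 0) (c 1)).
Proof.
move=> gc t01; have [u u01 near] := exists_nearest_point p gc.
have i0 : 0 <= (0 : R) <= 1 by rewrite lexx ler01.
have i1 : 0 <= (1 : R) <= 1 by rewrite lexx ler01.
rewrite (nearest_point_additive gc u01 t01 near).
rewrite (nearest_point_additive gc u01 i0 near).
rewrite (nearest_point_additive gc u01 i1 near).
rewrite (geodesicE gc u01 t01) (geodesicE gc u01 i0) (geodesicE gc u01 i1).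
move: u01 t01 => /andP[u0 u1] /andP[t0 t1].
rewrite subr0 (ger0_norm u0) (ler0_norm (_ : u - 1 <= 0)) ?subr_le0 //.
rewrite le_max; have [ut|/ltW tu] := leP u t; apply/orP; [right|left].
  rewrite ler0_norm ?subr_le0 // -subr_ge0 [leRHS](_ : _ = 0) //; ring.
rewrite ger0_norm ?subr_ge0 // -subr_ge0 [leRHS](_ : _ = 0) //; ring.
Qed.

End tripod.

(** * Inductive means in an R-tree *)

Section tree_inequalities.
Context {R : realType} {T : completeMetricType R}.
Implicit Types (p x y z b : T) (s t u v : R).
Hypothesis treeT : R_tree T.

Lemma dist_geodesic_point_le p x y t : 0 <= t <= 1 ->
  mdist p (geodesic_point x y t) <=
  Num.max (mdist p x - t * mdist x y) (mdist p y - (1 - t) * mdist x y).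
Proof.
move=> t01; rewrite /geodesic_point; case: xgetP => [q _ [c [gc c0 c1] ->]|no].
  by rewrite -c0 -c1; exact: dist_geodesic_le.
by have [c xyc] := treeT.1 x y; case: (no (c t)); exists c.
Qed.

(** Joint convexity of the distance.  Applying the preceding inequality in each
of the two geodesics bounds the left side by the maximum of four expressions, and
each of them is a consequence of triangle inequalities between the four end
points. *)
Lemma dist_geodesic_point2_le x y x' y' t : 0 <= t <= 1 ->
  mdist (geodesic_point x y t) (geodesic_point x' y' t) <=
  (1 - t) * mdist x x' + t * mdist y y'.
Proof.
move=> t01; set p := geodesic_point x y t; set q := geodesic_point x' y' t.
have h3 := dist_geodesic_point_le q x y t01.
have h2 := dist_geodesic_point_le x x' y' t01.
have h1 := dist_geodesic_point_le y x' y' t01.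
rewrite -/p -/q (metric_sym q x) (metric_sym q y) (metric_sym q p) in h1 h2 h3.
have xy1 := metric_triangle x x' y'; have xy2 := metric_triangle x y y'.
have yx1 := metric_triangle y x x'; have yx2 := metric_triangle y y' x'.
have xx := metric_triangle x y x'; have yy := metric_triangle y x y'.
rewrite (metric_sym y x) (metric_sym y' x') in yx1 yx2 yy.
case/andP: t01 => t0 t1; have u0 : 0 <= 1 - t by rewrite subr_ge0.
move: (mdist x y) (mdist x' y') (mdist x y') (mdist y x') (mdist x q) (mdist y q)
  (mdist p q) (mdist x x') (mdist y y') xy1 xy2 yx1 yx2 xx yy h1 h2 h3.
move=> L L' xy' yx' xq yq D X Y xy1 xy2 yx1 yx2 xx yy; rewrite !le_max.
move=> h1 h2 h3; rewrite -subr_ge0.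
case/orP: h3 => h3; [case/orP: h2 => h2|case/orP: h1 => h1].
- have := mulr_ge0 t0 (_ : 0 <= Y - X + L + L').
  by move=> /(_ ltac:(lra)); clear -h2 h3; nra.
- have := mulr_ge0 t0 (_ : 0 <= Y + L - xy').
  have := mulr_ge0 u0 (_ : 0 <= X + L' - xy').
  by move=> /(_ ltac:(lra)) h4 /(_ ltac:(lra)); clear -h2 h3 h4; nra.
- have := mulr_ge0 t0 (_ : 0 <= Y + L' - yx').
  have := mulr_ge0 u0 (_ : 0 <= X + L - yx').
  by move=> /(_ ltac:(lra)) h4 /(_ ltac:(lra)); clear -h1 h3 h4; nra.
- have := mulr_ge0 u0 (_ : 0 <= X - Y + L + L').
  by move=> /(_ ltac:(lra)); clear -h1 h3; nra.
Qed.

(** This CAT(0) inequality makes the mean square distance strongly convex. *)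
Lemma sqr_dist_midpoint_le p x y :
  mdist p (geodesic_point x y 2^-1) ^+ 2 <=
  2^-1 * mdist p x ^+ 2 + 2^-1 * mdist p y ^+ 2 - 4^-1 * mdist x y ^+ 2.
Proof.
have h : 0 <= (2^-1 : R) <= 1 by apply/andP; split; lra.
have := dist_geodesic_point_le p x y h.
have := metric_triangle p x y; have := metric_triangle p y x.
have := metric_triangle x p y.
rewrite (metric_sym y x) (metric_sym x p).
have := mdist_ge0 p (geodesic_point x y 2^-1).
move: (mdist _ (geodesic_point _ _ _)) (mdist p x) (mdist p y) (mdist x y).
move=> m a c l m0 lac acl cal; rewrite le_max => /orP[] ml.
  have : m ^+ 2 <= (a - 2^-1 * l) ^+ 2.
    by rewrite lerXn2r // nnegrE //; lra.
  by nra.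
have : m ^+ 2 <= (c - (1 - 2^-1) * l) ^+ 2.
  by rewrite lerXn2r // nnegrE //; lra.
by nra.
Qed.

Lemma inductive_meanSS (y : nat -> T) n : inductive_mean y n.+2 =
  geodesic_point (inductive_mean y n.+1) (y n.+1) n.+2%:R^-1.
Proof. by []. Qed.

Lemma inductive_mean_eq (y y' : nat -> T) n : (0 < n)%N ->
  (forall i, (i < n)%N -> y i = y' i) ->
  inductive_mean y n = inductive_mean y' n.
Proof.
elim: n => // -[|n] ih _ yy'; first by rewrite /= yy'.
rewrite !inductive_meanSS yy' // ih // => i ni.
by rewrite yy' // ltnS ltnW.
Qed.

Lemma invnat_itv n : 0 <= (n.+1%:R^-1 : R) <= 1.
Proof. by rewrite invr_ge0 ler0n invf_le1 ?ltr0n // ler1n. Qed.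

Lemma natSS_invB n : n.+2%:R * (1 - n.+2%:R^-1) = n.+1%:R :> R.
Proof. by rewrite mulrBr mulr1 divff ?pnatr_eq0 // -[n.+2%:R]natr1 addrK. Qed.

Lemma inductive_mean_lipschitz (y y' : nat -> T) n :
  n%:R * mdist (inductive_mean y n) (inductive_mean y' n) <=
  \sum_(i < n) mdist (y i) (y' i).
Proof.
elim: n => [|[|n] ih]; first by rewrite mul0r big_ord0.
  by rewrite mul1r big_ord_recl big_ord0 addr0.
rewrite big_ord_recr !inductive_meanSS.
apply: le_trans (lerD ih (lexx _)).
have := dist_geodesic_point2_le (inductive_mean y n.+1) (y n.+1)
  (inductive_mean y' n.+1) (y' n.+1) (invnat_itv n.+1).
rewrite -(ler_pM2l (_ : 0 < n.+2%:R)) ?ltr0n // => /le_trans; apply.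
by rewrite mulrDr !mulrA natSS_invB divff ?pnatr_eq0 // mul1r.
Qed.

(** For [n = 0] the value [inductive_mean y 0] is [y 0] and has weight 0, so that
no case distinction is needed in what follows. *)
Lemma inductive_mean_step (y : nat -> T) n b :
  n.+1%:R * mdist b (inductive_mean y n.+1) <=
  Num.max (n.+1%:R * mdist b (inductive_mean y n) -
             mdist (inductive_mean y n) (y n))
          (n.+1%:R * mdist b (y n) - n%:R * mdist (inductive_mean y n) (y n)).
Proof.
case: n => [|n]; first by rewrite !mul1r mdistxx subr0 mul0r subr0 maxxx.
rewrite inductive_meanSS.
have := dist_geodesic_point_le b (inductive_mean y n.+1) (y n.+1)
  (invnat_itv n.+1).
rewrite -(ler_pM2l (_ : 0 < n.+2%:R)) ?ltr0n // => /le_trans; apply.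
by rewrite maxr_pMr ?ler0n // !mulrBr !mulrA natSS_invB divff ?pnatr_eq0 // mul1r.
Qed.

(** The Gromov product: in a tree, the length of the common initial piece of the
geodesics from [b] to [x] and to [y].  It vanishes when [x] and [y] are on
different sides of [b]. *)
Definition gromov b x y := (mdist b x + mdist b y - mdist x y) / 2.

Lemma inductive_mean_growth (y : nat -> T) n b :
  n.+1%:R * mdist b (inductive_mean y n.+1) <=
  n%:R * mdist b (inductive_mean y n) + mdist b (y n).
Proof.
apply: le_trans (inductive_mean_step y n b) _.
set s := inductive_mean y n.
have := metric_triangle b (y n) s; have := metric_triangle b s (y n).
rewrite (metric_sym (y n) s) -natr1; have : 0 <= n%:R :> R by [].
move: (n%:R : R) (mdist b s) (mdist b (y n)) (mdist s (y n)) => N a q l N0 qal aql.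
have := mulr_ge0 N0 (_ : 0 <= a + l - q); rewrite subr_ge0 => /(_ qal) h.
by rewrite ge_max; apply/andP; split; clear -h aql; nra.
Qed.

(** For [h = 0] the geodesic from [S_n] to [y n] passes through [b]; a Gromov
product up to [h] adds at most [2 h] to the distance of [S_(n+1)] from [b]. *)
Lemma inductive_mean_reflect (y : nat -> T) n b (h : R) :
  gromov b (inductive_mean y n) (y n) <= h ->
  n.+1%:R * mdist b (inductive_mean y n.+1) <=
  `|n%:R * mdist b (inductive_mean y n) - mdist b (y n)| + 2 * n.+1%:R * h.
Proof.
rewrite /gromov => gh; apply: le_trans (inductive_mean_step y n b) _.
move: gh; set s := inductive_mean y n.
have := metric_triangle s b (y n); rewrite (metric_sym s b).
rewrite -[n.+1%:R]natr1; have : 0 <= n%:R :> R by [].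
move: (n%:R : R) (mdist b s) (mdist b (y n)) (mdist s (y n)).
move=> N a q l N0 tri gh; have nrm := ler_norm (N * a - q).
have nrmN := ler_norm (- (N * a - q)); rewrite normrN in nrmN.
have h0 : 0 <= h by lra.
have Nh := mulr_ge0 N0 h0.
have := mulr_ge0 N0 (_ : 0 <= 2 * h - (a + q - l)).
move=> /(_ ltac:(lra)) Nl.
by rewrite ge_max; apply/andP; split; clear -gh h0 Nh Nl nrm nrmN; nra.
Qed.

End tree_inequalities.

(** * The barycenter *)

Section borel_metric.
Context {R : realType} {T : completeMetricType R}.
Implicit Types (x y z : T) (e : R).

Lemma open_mdist_ball z e : open (ball z e).
Proof.
rewrite openE => y; rewrite ballEmdist /= => zy.
apply/nbhs_ballP; exists (e - mdist z y); first by rewrite /= subr_gt0.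
move=> w; rewrite !ballEmdist /= ltrBrDl.
exact/le_lt_trans/metric_triangle.
Qed.

Lemma measurable_open (U : set T) : open U -> measurable (U : set (borel T)).
Proof. by move=> oU; exact: sub_sigma_algebra. Qed.

Lemma measurable_closed (F : set T) :
  closed F -> measurable (F : set (borel T)).
Proof.
by move=> /closed_openC/measurable_open/measurableC; rewrite setCK.
Qed.

Lemma measurable_mdist x (A : set (borel T)) :
  measurable_fun A (fun y : borel T => mdist x (y : T)).
Proof.
apply: (@measurable_funS _ _ _ _ [set: borel T]) => //.
apply: (measurability _ (RGenInftyO.measurableE R)) => _ [_ [e ->] <-].
rewrite setTI (_ : _ @^-1` _ = ball x e); first exact: (measurable_open (@open_mdist_ball x e)).
by rewrite ballEmdist; apply/seteqP; split => y /=; rewrite in_itv.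
Qed.

End borel_metric.

Section mean_square.
Context {R : realType} {T : completeMetricType R}.
Variable nu : probability (borel T) R.
Variables (S : set T) (D : R) (z0 : T).
Implicit Types (x y z : T) (e : R).
Hypothesis treeT : R_tree T.
Hypotheses (closedS : closed S) (fullS : nu (~` S) = 0%E) (Sz0 : S z0).
Hypothesis diamS : forall x y, S x -> S y -> mdist x y <= D.

Let mS : measurable (S : set (borel T)) := measurable_closed closedS.

Lemma diam_ge0 : 0 <= D.
Proof. by rewrite (le_trans (mdist_ge0 z0 z0)) // diamS. Qed.

Lemma measure_support : nu S = 1%E.
Proof.
rewrite -[S]setCK probability_setC; last exact: measurableC.
by rewrite fullS sube0.
Qed.

Lemma bounded_integrable (f : borel T -> R) (A : set (borel T)) (C : R) :
  measurable A -> measurable_fun A f ->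
  (forall y, A y -> `|f y| <= C) -> nu.-integrable A (EFin \o f).
Proof.
move=> mA mf fC; apply: measurable_bounded_integrable => //.
  by rewrite (le_lt_trans (probability_le1 nu mA)) // ltry.
exists C; split => [|M CM y Ay]; first exact: num_real.
exact: le_trans (fC y Ay) (ltW CM).
Qed.

Lemma mdist_support_le x y : S y -> mdist x y <= mdist x z0 + D.
Proof.
by move=> Sy; rewrite (le_trans (metric_triangle _ z0 _)) // lerD2l diamS.
Qed.

Lemma integrable_sqr_mdist x (A : set (borel T)) : measurable A -> A `<=` S ->
  nu.-integrable A (EFin \o (fun y : borel T => mdist x (y : T) ^+ 2)).
Proof.
move=> mA AS; apply: (@bounded_integrable _ _ ((mdist x z0 + D) ^+ 2)) => //.
  by apply: measurable_funX; exact: measurable_mdist.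
move=> y /AS Sy; rewrite ger0_norm ?sqr_ge0 //.
rewrite lerXn2r ?nnegrE ?mdist_ge0 //; first by rewrite addr_ge0 ?mdist_ge0 ?diam_ge0.
exact: mdist_support_le.
Qed.

Definition second_moment x : R := \int[nu]_(y in (S : set (borel T))) (mdist x (y : T) ^+ 2).

Lemma mean_square_distanceE x : mean_square_distance nu x = (second_moment x)%:E.
Proof.
rewrite /mean_square_distance.
rewrite (@ge0_negligible_integral _ _ _ _ _ (~` S : set (borel T))) //.
- rewrite setDE setCK setTI /second_moment /Rintegral fineK //.
  exact: integrable_fin_num (integrable_sqr_mdist x mS (fun _ => id)).
- exact: measurableC.
- apply/measurable_EFinP; apply: measurable_funX; exact: measurable_mdist.
- by move=> y _; rewrite lee_fin sqr_ge0.
Qed.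

Lemma second_moment_ge0 x : 0 <= second_moment x.
Proof. by apply: Rintegral_ge0 => y _; rewrite sqr_ge0. Qed.

(** The form in which pointwise inequalities between squared distances are
integrated: [S] has measure 1, so the constant is kept. *)
Lemma second_moment_affine_le x y z (a b c : R) :
  (forall w, S w -> mdist x w ^+ 2 <= a * mdist y w ^+ 2 + b * mdist z w ^+ 2 + c) ->
  second_moment x <= a * second_moment y + b * second_moment z + c.
Proof.
move=> h; have ix v := integrable_sqr_mdist v mS (fun _ => id).
have iZ v (d : R) : nu.-integrable S (EFin \o (fun w : borel T => d * mdist v (w : T) ^+ 2)).
  exact: integrableZl (ix v).
have ic : nu.-integrable S (EFin \o (fun _ : borel T => c)).
  by apply: (@bounded_integrable _ _ `|c|).
have iD : nu.-integrable S (EFin \o (fun w : borel T => a * mdist y (w : T) ^+ 2 + b * mdist z (w : T) ^+ 2)).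
  exact: integrableD (iZ y a) (iZ z b).
rewrite /second_moment -!RintegralZl //.
have := Rintegral_cst nu mS c.
rewrite (_ : fine _ = 1) ?mulr1 => [<-|]; last by rewrite -[RHS]/(fine 1%E) -measure_support.
rewrite -RintegralD // -RintegralD //.
apply: le_Rintegral => //.
exact: integrableD iD ic.
Qed.

(** Strong convexity gives both existence and uniqueness of the minimizer. *)
Lemma second_moment_midpoint x y : second_moment (geodesic_point x y 2^-1) <=
  2^-1 * second_moment x + 2^-1 * second_moment y - 4^-1 * mdist x y ^+ 2.
Proof.
apply: second_moment_affine_le => w _.
rewrite !(metric_sym _ w); exact: sqr_dist_midpoint_le.
Qed.

Lemma second_moment_continuity x b :
  second_moment b <= second_moment x + 2 * (mdist b z0 + D) * mdist b x.
Proof.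
have -> : second_moment x + 2 * (mdist b z0 + D) * mdist b x =
  1 * second_moment x + 0 * second_moment x + 2 * (mdist b z0 + D) * mdist b x by ring.
apply: second_moment_affine_le => w Sw; rewrite mul1r mul0r addr0.
have := mdist_support_le b Sw; have := metric_triangle b x w.
have := mdist_ge0 b x; have := mdist_ge0 b w; have := mdist_ge0 x w.
move: (mdist b w) (mdist x w) (mdist b x) (mdist b z0 + D) => q a l C.
move=> a0 q0 l0 qal qC.
have h1 := mulr_ge0 l0 (_ : 0 <= C - q); rewrite subr_ge0 in h1.
have := h1 qC => {}h1.
have [qa|aq] := leP q a.
  have : q ^+ 2 <= a ^+ 2 by rewrite lerXn2r.
  have : 0 <= C * l by rewrite mulr_ge0 // (le_trans q0).
  by move=> h2 h3; rewrite -mulrA; lra.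
have h2 : (q - a) * (q + a) <= l * (q + q).
  by apply: ler_pM; lra.
nra.
Qed.

(** By strong convexity the mutual distances in a minimizing sequence are
controlled by the excess of the second moment over its infimum, so the sequence
is Cauchy and converges in the complete space. *)
Lemma exists_minimizer : exists b, forall x, x != b -> second_moment b < second_moment x.
Proof.
pose E := [set second_moment x | x in [set: T]].
have lbE : lbound E 0 by move=> _ [x _ <-]; exact: second_moment_ge0.
have infE : has_inf E by split; [exists (second_moment z0), z0|exists 0].
set m := inf E.
have mV x : m <= second_moment x by apply: (ge_inf infE.2); exists x.
have ex (k : nat) : exists x, second_moment x < m + k.+1%:R^-1.
  have [|_ [x _ <-] ?] := @inf_adherent _ E k.+1%:R^-1 _ infE.
    by rewrite invr_gt0.
  by exists x.
have [u uV] := choice ex.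
have close k l : (k <= l)%N -> mdist (u k) (u l) ^+ 2 <= 4 * k.+1%:R^-1.
  move=> kl; have := second_moment_midpoint (u k) (u l).
  have := mV (geodesic_point (u k) (u l) 2^-1); have := uV k; have := uV l.
  have : l.+1%:R^-1 <= k.+1%:R^-1 :> R by rewrite lef_pV2 ?posrE // ler_nat.
  move: (k.+1%:R^-1 : R) (l.+1%:R^-1 : R) (mdist _ _ ^+ 2) => i j dd.
  by lra.
have /cauchy_cvg/cvg_ex[b ub] : cauchy (u @ \oo).
  apply: cauchy_exP => e e0.
  have [k ke] : exists k : nat, 4 * k.+1%:R^-1 < e ^+ 2.
    exists (Num.truncn (4 / e ^+ 2)).
    rewrite ltr_pdivrMr ?ltr0n // mulrC -ltr_pdivrMr ?exprn_gt0 //.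
    exact: truncnS_gt.
  exists (u k); exists k => // l /= kl; rewrite ballEmdist /=.
  rewrite -(@ltr_pXn2r _ 2) ?nnegrE ?mdist_ge0 ?(ltW e0) //.
  exact: le_lt_trans (close _ _ kl) ke.
have Vb : second_moment b <= m.
  apply/ler_addgt0Pl => e e0; set C := 2 * (mdist b z0 + D).
  have C0 : 0 <= C by rewrite mulr_ge0 ?addr_ge0 ?mdist_ge0 ?diam_ge0.
  have e2 : 0 < e / 2 by rewrite divr_gt0.
  have eC : 0 < e / 2 / (C + 1) by rewrite divr_gt0 // ltr_wpDl.
  have /cvg_ballP/(_ _ eC)[N _ uN] := ub.
  pose k := maxn N (Num.truncn (e / 2)^-1).
  have := uN k (leq_maxl _ _); rewrite ballEmdist /= => bk.
  have kk : k.+1%:R^-1 < e / 2.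
    rewrite -[ltRHS]invrK ltf_pV2 ?posrE ?invr_gt0 //.
    apply: lt_le_trans (truncnS_gt _) _.
    by rewrite ler_nat ltnS leq_maxr.
  have := second_moment_continuity (u k) b; have := uV k; rewrite -/C.
  have : C * mdist b (u k) <= e / 2.
    have : (C + 1) * mdist b (u k) <= e / 2.
      by rewrite mulrC -ler_pdivlMr ?ltW // ltr_wpDl.
    by have := mdist_ge0 b (u k); rewrite mulrDl mul1r; lra.
  move: (C * _) (k.+1%:R^-1 : R) kk => c j.
  by lra.
exists b => x xb; have := second_moment_midpoint b x.
have := mV (geodesic_point b x 2^-1); have : 0 < mdist b x ^+ 2.
  by rewrite exprn_gt0 // mdist_gt0 eq_sym.
by lra.
Qed.

Let b := barycenter nu.

Lemma barycenter_lt x : x != b -> second_moment b < second_moment x.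
Proof.
have [b' b'P] := exists_minimizer.
rewrite /b /barycenter; case: xgetP => [c _ cP xc|no].
  by have := cP x xc; rewrite !mean_square_distanceE lte_fin.
by case: (no b') => y /b'P; rewrite !mean_square_distanceE lte_fin.
Qed.

Lemma barycenter_le x : second_moment b <= second_moment x.
Proof. by have [->//|/barycenter_lt/ltW] := eqVneq x b. Qed.

(** If [q = d(b, y)] were larger than [D], moving [b] by [q - D] towards [y]
would not increase its distance to any point of [S], against the uniqueness of
the minimizer. *)
Lemma barycenter_mdist_le y : S y -> mdist b y <= D.
Proof.
move=> Sy; rewrite leNgt; apply/negP => Dq.
set q := mdist b y in Dq; have q0 : 0 < q := le_lt_trans diam_ge0 Dq.
(* The parameter [t] is chosen such that [c] is at distance [D] from [y]. *)
pose t := (q - D) / q; pose c := geodesic_point b y t.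
have tq : t * q = q - D by rewrite /t divfK // gt_eqF.
have t01 : 0 <= t <= 1.
  apply/andP; split; first by rewrite divr_ge0 ?subr_ge0 // ltW.
  rewrite ler_pdivrMr // mul1r.
  by have := diam_ge0; lra.
have near w : S w -> mdist c w <= mdist b w.
  move=> Sw; have := dist_geodesic_point_le treeT w b y t01.
  rewrite -/c (metric_sym w c) (metric_sym w b) -/q mulrBl mul1r tq.
  have := diamS Sw Sy; have := mdist_ge0 b w.
  by rewrite le_max => h1 h2 /orP[] h3; lra.
have cb : c != b.
  apply/eqP => cb; have := dist_geodesic_point_le treeT y b y t01.
  rewrite -/c cb (metric_sym y b) mdistxx -/q mulrBl mul1r tq.
  by rewrite le_max => /orP[] h; have := diam_ge0; lra.
have := barycenter_lt cb; rewrite ltNge => /negP; apply.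
have -> : second_moment b = 1 * second_moment b + 0 * second_moment b + 0 by ring.
apply: second_moment_affine_le => w Sw; rewrite mul1r mul0r !addr0.
by rewrite lerXn2r ?nnegrE ?mdist_ge0 // near.
Qed.

End mean_square.

(** * The first-order condition at the barycenter *)

(** The signed distance from [b] to [y] in the direction of [x].  A positive
threshold [h] makes the sign stable: a small change of [y] can only bring it to
the sign given by a slightly different threshold. *)
Definition drift {R : realType} {T : completeMetricType R} (b : T) (h : R)
    (x y : T) : R :=
  if h <= gromov b x y then mdist b y else - mdist b y.

Section cells.
Context {R : realType} {T : completeMetricType R}.
Variable nu : probability (borel T) R.
Variables (S : set T) (D : R) (z0 : T).
Implicit Types (x y : T) (z : nat -> T) (e : R).
Hypothesis treeT : R_tree T.
Hypotheses (closedS : closed S) (fullS : nu (~` S) = 0%E) (Sz0 : S z0).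
Hypothesis diamS : forall x y, S x -> S y -> mdist x y <= D.

(** Removing the balls one after the other makes the cells below disjoint. *)
Fixpoint rest z e k : set (borel T) :=
  if k is j.+1 then rest z e j `\` ball (z j) e else S.

Definition cell z e k : set (borel T) := rest z e k `&` ball (z k) e.

Lemma restP z e k y :
  rest z e k y <-> S y /\ forall j, (j < k)%N -> ~ ball (z j) e y.
Proof.
elim: k => [|k ih] /=; first by split => [Sy|[]].
split=> [[/ih[Sy yk] yz]|[Sy yk]].
  by split => // j; rewrite ltnS leq_eqVlt => /predU1P[->|/yk].
by split; [apply/ih; split => // j jk; apply/yk/ltnW|exact: yk].
Qed.

Lemma rest_sub z e k : rest z e k `<=` S.
Proof. by move=> y /restP[]. Qed.

Lemma measurable_mdist_ball x e : measurable (ball x e : set (borel T)).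
Proof. exact: (measurable_open (@open_mdist_ball _ _ x e)). Qed.

Lemma measurable_rest z e k : measurable (rest z e k).
Proof.
elim: k => [|k ih] /=; first exact: measurable_closed.
by apply: measurableD => //; exact: measurable_mdist_ball.
Qed.

Lemma measurable_cell z e k : measurable (cell z e k).
Proof. by apply: measurableI; [exact: measurable_rest|exact: measurable_mdist_ball]. Qed.

Lemma Rintegral_cells z e k (f : borel T -> R) : nu.-integrable S (EFin \o f) ->
  \int[nu]_(y in (S : set (borel T))) f y =
  \sum_(j < k) \int[nu]_(y in cell z e j) f y + \int[nu]_(y in rest z e k) f y.
Proof.
move=> intf; elim: k => [|k ->]; first by rewrite big_ord0 add0r.
rewrite big_ord_recr /= -addrA; congr (_ + _).
have UE : rest z e k = cell z e k `|` rest z e k.+1.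
  by rewrite /cell /= setUIDK.
rewrite {1}UE Rintegral_setU //.
- exact: measurable_cell.
- exact: measurable_rest.
- rewrite -UE; apply: integrableS intf; [exact: measurable_closed|exact: measurable_rest|].
  exact: rest_sub.
- by apply/disj_set2P; rewrite -subset0 => y [[_ ?] [_]].
Qed.

Definition mass z e k : R := fine (nu (cell z e k)).
Definition rest_mass z e k : R := fine (nu (rest z e k)).

Lemma mass_ge0 z e k : 0 <= mass z e k.
Proof. by rewrite fine_ge0. Qed.

Lemma rest_mass_ge0 z e k : 0 <= rest_mass z e k.
Proof. by rewrite fine_ge0. Qed.

Lemma sum_mass z e k : \sum_(j < k) mass z e j + rest_mass z e k = 1.
Proof.
have mS := measurable_closed closedS.
have int1 : nu.-integrable S (EFin \o (fun _ : borel T => 1 : R)).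
  by apply: (@bounded_integrable _ _ _ _ _ 1) => // y _; rewrite normr1.
have := Rintegral_cells z e k int1.
rewrite !Rintegral_cst ?mul1r //; last exact: measurable_rest.
rewrite (_ : fine (nu S) = 1); last first.
  by rewrite -[RHS]/(fine 1%E) -(measure_support closedS fullS).
move=> ->; congr (_ + _); apply: eq_bigr => j _.
by rewrite Rintegral_cst ?mul1r //; exact: measurable_cell.
Qed.

Lemma Rintegral_cells_le z e k (f : borel T -> R) (c : R) (u : nat -> R) :
    nu.-integrable S (EFin \o f) ->
    (forall j y, (j < k)%N -> cell z e j y -> f y <= u j) ->
    (forall y, S y -> f y <= c) ->
  \int[nu]_(y in (S : set (borel T))) f y <=
  \sum_(j < k) u j * mass z e j + c * rest_mass z e k.
Proof.
move=> intf fu fc; rewrite (Rintegral_cells z e k intf).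
have mS := measurable_closed closedS.
have le (A : set (borel T)) (a : R) : measurable A -> A `<=` S -> (forall y, A y -> f y <= a) ->
    \int[nu]_(y in A) f y <= a * fine (nu A).
  move=> mA AS fa; rewrite -Rintegral_cst //; apply: le_Rintegral => //.
    exact: integrableS intf.
  by apply: (@bounded_integrable _ _ _ _ _ `|a|) => // y _.
apply: lerD; last first.
  apply: le => [||y /rest_sub Sy]; [exact: measurable_rest|exact: rest_sub|exact: fc].
apply: ler_sum => j _; apply: le => [||y]; first exact: measurable_cell.
  by move=> y [/rest_sub].
exact: fu.
Qed.

Local Notation b := (barycenter nu).

(** The second moment at the point at distance [h] from [b] towards [x] is no
smaller than at [b].  For [y] of positive side the squared distance to [y]
changes by at most [h^2 - 2 h d(b, y)], else by at most [h^2 + 2 h d(b, y)], so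
integrating bounds the mean drift by [h / 2].  The other errors come from
replacing [y] by the center of its cell, and from the mass outside the cells. *)
Lemma barycenter_drift_le z e k (h : R) x : (forall j, S (z j)) ->
    0 < h -> 0 <= e <= h ->
  \sum_(j < k) drift b (2 * h) x (z j) * mass z e j <=
  h / 2 + e + D * rest_mass z e k.
Proof.
move=> Sz h0 /andP[e0 eh]; have D0 := diam_ge0 Sz0 diamS.
(* If [x] is closer than [h] to [b], all Gromov products are below the threshold
and every drift is nonpositive. *)
have [xh|hx] := ltP (mdist b x) h.
  apply: (@le_trans _ _ 0); last first.
    by rewrite !addr_ge0 ?mulr_ge0 ?rest_mass_ge0 // ltW.
  apply: sumr_le0 => j _; rewrite /drift ifF; last first.
    apply/negbTE; rewrite -ltNge /gromov.
    by have := metric_triangle b x (z j); lra.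
  by rewrite mulNr oppr_le0 mulr_ge0 ?mass_ge0 ?mdist_ge0.
set a := mdist b x in hx; have a0 : 0 < a := lt_le_trans h0 hx.
pose t := h / a; have ta : t * a = h by rewrite /t divfK // gt_eqF.
have t01 : 0 <= t <= 1.
  apply/andP; split; first by rewrite divr_ge0 // ltW.
  by rewrite ler_pdivrMr // mul1r.
pose c := geodesic_point b x t.
have cw w : mdist c w <= Num.max (mdist b w - h) (mdist x w - a + h).
  have := dist_geodesic_point_le treeT w b x t01.
  by rewrite -/c -/a !(metric_sym _ w) mulrBl mul1r ta opprB addrA addrAC.
pose f (w : borel T) : R := mdist c (w : T) ^+ 2 - mdist b (w : T) ^+ 2.
have mS := measurable_closed closedS.
have iS y := integrable_sqr_mdist nu Sz0 diamS y mS (fun _ => id).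
have intf : nu.-integrable S (EFin \o f) by exact: integrableB (iS c) (iS b).
have f_le w : S w -> f w <= h ^+ 2 + 2 * h * mdist b w.
  move=> Sw; have : mdist c w <= mdist b w + h.
    apply: le_trans (cw w) _; have := metric_triangle x b w.
    by rewrite (metric_sym x b) -/a ge_max => ?; apply/andP; split; lra.
  by rewrite /f; have := mdist_ge0 c w; have := mdist_ge0 b w; nra.
have f_cell j w : (j < k)%N -> cell z e j w ->
    f w <= h ^+ 2 - 2 * h * (drift b (2 * h) x (z j) - e).
  move=> _ [/rest_sub Sw]; rewrite ballEmdist /= => zw.
  rewrite /drift /gromov; case: ifPn => [|_]; last first.
    apply: le_trans (f_le w Sw) _.
    have := metric_triangle b (z j) w => tri.
    have : 0 <= h * (mdist b (z j) + e - mdist b w).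
      by rewrite mulr_ge0 ?ltW //; lra.
    by lra.
  (* The threshold [2 h] at the center leaves a Gromov product of at least [h] at
  [w], so moving by [h] towards [x] brings one closer to [w] by [h]. *)
  rewrite ler_pdivlMr // => hg.
  have tri1 := metric_triangle b w (z j); rewrite (metric_sym w) in tri1.
  have tri2 := metric_triangle x (z j) w.
  have cw1 : mdist c w <= mdist b w - h.
    apply: le_trans (cw w) _; rewrite ge_max lexx /= -/a in hg *; lra.
  have tri3 := metric_triangle b (z j) w; have c0 := mdist_ge0 c w.
  have : mdist c w ^+ 2 <= (mdist b w - h) ^+ 2 by rewrite lerXn2r ?nnegrE //; lra.
  have : 0 <= h * (mdist b w + e - mdist b (z j)).
    by rewrite mulr_ge0 ?ltW //; lra.
  by rewrite /f; nra.
have f_rest w : S w -> f w <= h ^+ 2 + 2 * h * D.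
  move=> Sw; apply: le_trans (f_le w Sw) _; rewrite lerD2l ler_wpM2l //.
    by rewrite mulr_ge0 // ltW.
  exact: (barycenter_mdist_le treeT closedS fullS Sz0 diamS).
have := Rintegral_cells_le intf f_cell f_rest.
have : 0 <= \int[nu]_(y in (S : set (borel T))) f y.
  rewrite RintegralB // subr_ge0.
  exact: (barycenter_le treeT closedS fullS Sz0 diamS).
have := sum_mass z e k; set r := rest_mass z e k.
set s := \sum_(j < k) drift _ _ _ _ * _.
have -> : \sum_(j < k) (h ^+ 2 - 2 * h * (drift b (2 * h) x (z j) - e)) * mass z e j
  = (h ^+ 2 + 2 * h * e) * (\sum_(j < k) mass z e j) - 2 * h * s.
  rewrite !mulr_sumr -sumrB; apply: eq_bigr => j _; ring.
move: (\sum_(j < k) mass z e j) => p pr i0 /(le_trans i0) {i0}.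
have r0 : 0 <= r := rest_mass_ge0 z e k.
have -> : p = 1 - r by rewrite -pr addrK.
move=> hh; rewrite -(ler_pM2l (_ : 0 < 2 * h)) ?mulr_gt0 //.
have : 0 <= h * e * r by rewrite !mulr_ge0 // ltW.
by move=> her; move: hh; nra.
Qed.

End cells.

(** * The support is separable *)

Section net.
Context {R : realType} {T : completeMetricType R}.
Variable nu : probability (borel T) R.
Variables (S : set T) (z0 : T).
Implicit Types (x y : T) (e : R) (l : seq T).
Hypotheses (Sz0 : S z0) (suppS : is_support nu S).

(** Otherwise the complement of the ball would be a smaller closed set of full
measure. *)
Lemma support_ball_gt0 x e : 0 < e -> S x -> (0 < nu (ball x e))%E.
Proof.
move=> e0 Sx; rewrite lt0e measure_ge0 andbT; apply/eqP => b0.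
have [_ _ /(_ (~` ball x e)) Smin] := suppS.
have /Smin : closed (~` ball x e) by exact/open_closedC/open_mdist_ball.
by rewrite setCK => /(_ b0 x Sx); apply; rewrite ballEmdist /= mdistxx.
Qed.

(** Points at mutual distance at least [e] whose balls of radius [e / 2] are not
too small: these balls are disjoint, so there are at most [m + 1] of them. *)
Definition separated e m l : bool :=
  all (fun x => `[< S x >] && ((m.+1%:R^-1)%:E <= nu (ball x (e / 2)))%E) l &&
  pairwise (fun x y => e <= mdist x y) l.

Lemma separated_measure e m l : 0 < e -> separated e m l ->
  (((size l)%:R * m.+1%:R^-1)%:E <= nu (\big[setU/set0]_(x <- l) ball x (e / 2)))%E.
Proof.
move=> e0; elim: l => [|x l ih]; first by rewrite mul0r big_nil measure0.
move=> /andP[/andP[/andP[_ xm] al] /andP[xl pl]].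
rewrite big_cons measureU; first last.
- rewrite -subset0 => y [xy]; rewrite -bigcup_seq => -[w wl wy].
  have xw : e <= mdist x w := allP xl w wl.
  move: xy wy; rewrite !ballEmdist /= (metric_sym w) => xy yw.
  by have := metric_triangle x y w; clear -xw xy yw; lra.
- by apply: bigsetU_measurable => w _; exact: measurable_mdist_ball.
- exact: measurable_mdist_ball.
rewrite [size _]/= -[(size l).+1%:R]natr1 mulrDl mul1r addrC EFinD; apply: leeD => //.
by apply: ih; apply/andP; split; [exact: al|exact: pl].
Qed.

Lemma separated_size e m l : 0 < e -> separated e m l -> (size l <= m.+1)%N.
Proof.
move=> e0 /(separated_measure e0) h.
have : (((size l)%:R * m.+1%:R^-1)%:E <= 1 :> \bar R)%E.
  apply: le_trans h (probability_le1 _ _).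
  by apply: bigsetU_measurable => w _; exact: measurable_mdist_ball.
by rewrite lee_fin ler_pdivrMr ?ltr0n // mul1r ler_nat.
Qed.

Lemma maximal_separated e m : 0 < e -> exists l : seq T, (forall x, x \in l -> S x) /\
  forall x, S x -> ((m.+1%:R^-1)%:E <= nu (ball x (e / 2)))%E ->
    exists2 y, y \in l & ball y e x.
Proof.
move=> e0; pose Q n := `[< exists2 l, separated e m l & size l = n >].
have Q0 : exists n, Q n by exists 0%N; apply/asboolP; exists [::].
have Qm n : Q n -> (n <= m.+1)%N by move=> /asboolP[l /(separated_size e0) + <-].
case: (ex_maxnP Q0 Qm) => n /asboolP[l ls sl] nmax.
exists l; split=> [x xl|x Sx xm].
  by move: ls => /andP[/allP/(_ _ xl)/andP[/asboolP]].
apply: contrapT => far.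
have : Q n.+1; last by move=> /nmax; rewrite ltnn.
apply/asboolP; exists (x :: l); last by rewrite /= sl.
move: ls; rewrite /separated /= => /andP[-> ->]; rewrite xm !andbT.
apply/andP; split; first exact/asboolP.
apply/allP => y yl; rewrite leNgt; apply/negP => xy; apply: far.
by exists y => //; rewrite ballEmdist /= metric_sym.
Qed.

(** Each point of the support lies in one of the sets covered by the maximal
separated lists of levels [0, 1, ...]; so the part left uncovered by the first
[M] lists decreases to the empty set, and its measure tends to 0. *)
Lemma finite_net e (h : R) : 0 < e -> 0 < h ->
  exists (z : nat -> T) (k : nat), (forall j, S (z j)) /\ rest_mass nu S z e k <= h.
Proof.
move=> e0 h0; have [closedS fullS _] := suppS.
have [l lP] := choice (fun m => maximal_separated m e0).
pose L M := flatten [seq l m | m <- iota 0 M].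
pose z M := nth z0 (L M).
pose G M : set (borel T) := rest S (z M) e (size (L M)).
have GP M y : G M y <-> S y /\ forall x, x \in L M -> ~ ball x e y.
  rewrite /G restP; split => -[Sy far]; split => //.
    by move=> x /(nthP z0)[j jL <-]; exact: far.
  by move=> j jL; apply: far; exact: mem_nth.
have mG M : measurable (G M) by exact: measurable_rest.
have LS M N x : (M <= N)%N -> x \in L M -> x \in L N.
  move=> MN /flattenP[s /mapP[m]]; rewrite mem_iota /= add0n => mM -> xm.
  apply/flattenP; exists (l m) => //; apply/mapP; exists m => //.
  by rewrite mem_iota /= add0n (leq_trans mM).
have Gdecr : nonincreasing_seq G.
  move=> M N MN; apply/subsetPset => y /GP[Sy far].
  by apply/GP; split => // x /(LS _ _ _ MN); exact: far.
have G0 : \bigcap_M G M = set0.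
  rewrite -subset0 => y yG.
  have Sy : S y by have /GP[] := yG 0%N I.
  have pos : (0 < nu (ball y (e / 2)))%E by apply: support_ball_gt0 => //; rewrite divr_gt0.
  have fin : nu (ball y (e / 2)) \is a fin_num.
    by apply: fin_num_measure; exact: measurable_mdist_ball.
  pose p := fine (nu (ball y (e / 2))).
  have p0 : 0 < p by rewrite fine_gt0 // pos ltey_eq fin.
  (* The level [m] is such that [1 / (m + 1) <= p], so [y] is within [e] of a point
  of the list of level [m]. *)
  pose m := Num.truncn p^-1.
  have [|x xm xy] := (lP m).2 y Sy.
    rewrite -(fineK fin) lee_fin -/p -[leRHS]invrK lef_pV2 ?posrE ?invr_gt0 //.
    exact/ltW/truncnS_gt.
  have /GP[_ /(_ x)] := yG m.+1 I; apply => //.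
  apply/flattenP; exists (l m) => //; apply/mapP; exists m => //.
  by rewrite mem_iota add0n /=.
have G_cvg : nu \o G @ \oo --> 0%:E.
  rewrite [X in _ --> X](_ : _ = nu (\bigcap_M G M)); last by rewrite G0 measure0.
  apply: nonincreasing_cvg_mu => //.
    by rewrite (le_lt_trans (probability_le1 nu (mG 0%N))) // ltry.
  by rewrite G0.
have /fine_cvg/cvgrPdist_le/(_ h h0)[N _ /(_ N (leqnn N))] := G_cvg.
rewrite /= sub0r normrN ger0_norm ?fine_ge0 // => massN.
exists (z N), (size (L N)); split => // j; rewrite /z.
have [jL|jL] := ltnP j (size (L N)); last by rewrite nth_default.
have /flattenP[s /mapP[m _ ->] js] := mem_nth z0 jL.
exact: (lP m).1.
Qed.

End net.

(** * One step of the exponential moment *)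

Section hyperbolic.
Context {R : realType}.
Implicit Types a u v w x y : R.

Definition coshR x := (expR x + expR (- x)) / 2.
Definition sinhR x := (expR x - expR (- x)) / 2.

(** For [u <= 1/2], [e^u <= 1 / (1 - u) <= 1 + u + 2 u^2]; for [u >= 1/2],
[u <= 2 u^2]. *)
Lemma expR_le_sqr u : expR u <= u + expR (2 * u ^+ 2).
Proof.
have [u2|u2] := leP u 2^-1; last first.
  have : expR u <= expR (2 * u ^+ 2) by rewrite ler_expR; nra.
  by lra.
have : expR u <= 1 + u + 2 * u ^+ 2.
  have := expR_ge1Dx (- u); rewrite expRN => h.
  have e0 := expR_gt0 u.
  have : expR u * (1 - u) <= 1.
    by rewrite -[leRHS](mulfV (lt0r_neq0 e0)) ler_pM2l.
  have : 0 < 1 - u by lra.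
  have : 0 <= u ^+ 2 * (1 - 2 * u) by rewrite mulr_ge0 ?sqr_ge0 //; lra.
  move=> h1 h2 h3; rewrite -(ler_pM2r h2); apply: le_trans h3 _.
  by move: h1; nra.
by have := expR_ge1Dx (2 * u ^+ 2); lra.
Qed.

(** The term linear in [u] is kept: it is the one that averages to something
nonpositive, up to small errors. *)
Lemma coshR_add_le a u x : `|u| <= x ->
  coshR (a + u) <= coshR a * expR (2 * x ^+ 2) + u * sinhR a.
Proof.
move=> ux; have ux2 : expR (2 * u ^+ 2) <= expR (2 * x ^+ 2).
  by rewrite ler_expR ler_pM2l // -(real_normK (num_real u)) lerXn2r ?nnegrE // (le_trans _ ux).
have h1 := le_trans (expR_le_sqr u) (lerD (lexx u) ux2).
have h2 : expR (- u) <= - u + expR (2 * x ^+ 2).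
  by apply: le_trans (expR_le_sqr _) _; rewrite sqrrN lerD.
rewrite /coshR /sinhR opprD !expRD.
have := ler_wpM2l (expR_ge0 a) h1; have := ler_wpM2l (expR_ge0 (- a)) h2.
by lra.
Qed.

Lemma coshR_norm x : coshR `|x| = coshR x.
Proof.
by rewrite /coshR; case: ger0P => // _; rewrite opprK addrC.
Qed.

Lemma coshR_le x y : `|x| <= y -> coshR x <= coshR y.
Proof.
rewrite -(coshR_norm x); have : 0 <= `|x| by [].
move: `|x| => {}x x0 xy; rewrite /coshR ler_pM2r ?invr_gt0 //.
rewrite !expRN; have ex := expR_gt0 x; have ey := expR_gt0 y.
have exy : expR x <= expR y by rewrite ler_expR.
have e1 : 1 <= expR x by rewrite -expR0 ler_expR.
rewrite -subr_ge0 (_ : _ - _ = (expR y - expR x) * (1 - (expR x * expR y)^-1)).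
  rewrite mulr_ge0 ?subr_ge0 // invf_le1 ?mulr_gt0 //; nra.
by field; rewrite !gt_eqF.
Qed.

Lemma coshR_perturb y w v : 0 <= v -> `|y| <= `|w| + v -> coshR y <= coshR w * expR v.
Proof.
move=> v0 /coshR_le/le_trans; apply; rewrite -(coshR_norm w) /coshR opprD !expRD mulrAC.
rewrite ler_pM2r ?invr_gt0 // mulrDl lerD2l ler_wpM2l ?expR_ge0 //.
by rewrite ler_expR; lra.
Qed.

Lemma coshR_gt0 x : 0 < coshR x.
Proof. by rewrite divr_gt0 // addr_gt0 // expR_gt0. Qed.

Lemma sinhR_ge0 x : 0 <= x -> 0 <= sinhR x.
Proof. by move=> x0; rewrite divr_ge0 // subr_ge0 ler_expR; lra. Qed.

Lemma sinhR_le_coshR x : sinhR x <= coshR x.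
Proof. by rewrite ler_pM2r ?invr_gt0 //; have := expR_gt0 (- x); lra. Qed.

Lemma coshR_ge x : expR x / 2 <= coshR x.
Proof. by rewrite ler_pM2r ?invr_gt0 // lerDl expR_ge0. Qed.

(** The index [j] runs over the possible values of the next variable, with
probabilities [p j]; [X] is the present value of the walk, [h j] the increment
and [y j] the next value.  The drift bound is used through
[0 <= sinh <= cosh] at [lam * X]. *)
Lemma coshR_moment_step (k : nat) (p h y : nat -> R) (lam X D kap eta : R) :
    0 < lam -> 0 <= X -> 0 <= kap -> 0 <= eta ->
    (forall j, 0 <= p j) -> \sum_(j < k) p j <= 1 ->
    (forall j, `|h j| <= D) -> \sum_(j < k) h j * p j <= kap ->
    (forall j, 0 <= y j <= `|X + h j| + eta) ->
  \sum_(j < k) p j * coshR (lam * y j) <=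
  coshR (lam * X) * expR (2 * (lam * D) ^+ 2 + lam * kap + lam * eta).
Proof.
move=> lam0 X0 kap0 eta0 p0 p1 hD hk yX.
set m := expR (2 * (lam * D) ^+ 2).
have m1 : 1 <= m by rewrite -expR0 ler_expR mulr_ge0 ?sqr_ge0.
have term (j : 'I_k) : p j * coshR (lam * y j) <=
    expR (lam * eta) * (coshR (lam * X) * m * p j + lam * sinhR (lam * X) * (h j * p j)).
  have : coshR (lam * y j) <= coshR (lam * X + lam * h j) * expR (lam * eta).
    apply: coshR_perturb; first by rewrite mulr_ge0 // ltW.
    rewrite -mulrDr !normrM (gtr0_norm lam0) -mulrDr ler_pM2l //.
    by case/andP: (yX j) => y0; rewrite ger0_norm.
  have : coshR (lam * X + lam * h j) <= coshR (lam * X) * m + (lam * h j) * sinhR (lam * X).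
    by apply: coshR_add_le; rewrite normrM (gtr0_norm lam0) ler_pM2l.
  move=> h1 h2; have h3 := ler_wpM2r (expR_ge0 (lam * eta)) h1.
  have := ler_wpM2l (p0 j) (le_trans h2 h3) => /le_trans; apply.
  by rewrite le_eqVlt; apply/orP; left; apply/eqP; ring.
apply: le_trans (ler_sum _ (fun j _ => term j)) _.
rewrite -mulr_sumr big_split /= -!mulr_sumr.
rewrite (expRD _ (lam * eta)) mulrA [leLHS]mulrC ler_wpM2r ?expR_ge0 //.
have s0 : 0 <= sinhR (lam * X) by rewrite sinhR_ge0 // mulr_ge0 // ltW.
have c0 := coshR_gt0 (lam * X).
have h1 : coshR (lam * X) * m * \sum_(j < k) p j <= coshR (lam * X) * m.
  by rewrite ler_piMr // mulr_ge0 ?expR_ge0 // ltW.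
have h2 : lam * sinhR (lam * X) * (\sum_(j < k) h j * p j) <= lam * coshR (lam * X) * kap.
  apply: (@le_trans _ _ (lam * sinhR (lam * X) * kap)).
    by rewrite ler_wpM2l // mulr_ge0 // ltW.
  by rewrite ler_wpM2r // ler_wpM2l ?sinhR_le_coshR // ltW.
apply: le_trans (lerD h1 h2) _.
rewrite expRD -/m (_ : _ + _ = coshR (lam * X) * (m + lam * kap)); last by ring.
rewrite ler_pM2l //.
have := expR_ge1Dx (lam * kap); have : 0 <= lam * kap by rewrite mulr_ge0 // ltW.
move: m1; clear term h1 h2; clearbody m; move: m (expR (lam * kap)) (lam * kap) => {}m E q m1 q0 Eq; nra.
Qed.

End hyperbolic.

(** * Exponential moments over finite words *)

(** Words grow at the end, as appending a letter corresponds to taking one more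
variable into the inductive mean. *)
Fixpoint words (k n : nat) : seq (seq nat) :=
  if n is m.+1 then [seq rcons w j | w <- words k m, j <- index_iota 0 k]
  else [:: [::]].

Lemma size_words k n w : w \in words k n -> size w = n.
Proof.
elim: n w => [|n ih] w /=; first by rewrite inE => /eqP ->.
by move=> /allpairsP[[v j] [/= /ih <- _ ->]]; rewrite size_rcons.
Qed.

Lemma map_iota_words k n (f : nat -> nat) : (forall i, (i < n)%N -> (f i < k)%N) ->
  [seq f i | i <- iota 0 n] \in words k n.
Proof.
elim: n => [|n ih] fk; first by rewrite inE.
rewrite -{1}addn1 iotaD map_cat cats1; apply/allpairsP.
exists ([seq f i | i <- iota 0 n], f n) => /=; split => //.
  by apply: ih => i ni; exact/fk/ltnW.
by rewrite mem_index_iota fk.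
Qed.

Section moment.
Context {R : realType} {T : completeMetricType R}.
Implicit Types (b : T) (z : nat -> T) (w : seq nat).
Hypothesis treeT : R_tree T.

Definition spell z w i : T := z (nth 0%N w i).

Lemma drift_norm b (h : R) x y : `|drift b h x y| = mdist b y.
Proof.
by rewrite /drift; case: ifP => _; rewrite ?normrN ger0_norm ?mdist_ge0.
Qed.

(** One step of the mean as a reflected walk.  For the empty word the right side
does not depend on the base point of the drift, as its coefficient is 0 and
[|drift| = d(b, z j)]. *)
Lemma inductive_mean_drift b z w j (h : R) : 0 <= h ->
  (size w).+1%:R * mdist b (inductive_mean (spell z (rcons w j)) (size w).+1) <=
  `|(size w)%:R * mdist b (inductive_mean (spell z w) (size w)) +
    drift b h (inductive_mean (spell z w) (size w)) (z j)| + 2 * (size w).+1%:R * h.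
Proof.
move=> h0; have hn : 0 <= 2 * (size w).+1%:R * h by rewrite !mulr_ge0.
have wj : spell z (rcons w j) (size w) = z j.
  by rewrite /spell nth_rcons ltnn eqxx.
have [w0|w0] := posnP (size w).
  move: wj hn; rewrite w0 mul0r add0r mul1r drift_norm => wj hn.
  by rewrite [inductive_mean _ 1]/= wj lerDl.
have eqw : inductive_mean (spell z (rcons w j)) (size w) =
    inductive_mean (spell z w) (size w).
  by apply: inductive_mean_eq => // i iw; rewrite /spell nth_rcons iw.
rewrite /drift; case: ifPn => [hg|]; last rewrite -ltNge => /ltW hg.
  apply: le_trans (inductive_mean_growth treeT _ _ b) _.
  by rewrite eqw wj (le_trans (ler_norm _)) // lerDl.
have := @inductive_mean_reflect _ _ treeT (spell z (rcons w j)) (size w) b h.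
by rewrite eqw wj; apply.
Qed.

Variables (b : T) (z : nat -> T) (k N : nat) (p : nat -> R) (lam D kap h : R).
Hypotheses (lam0 : 0 < lam) (kap0 : 0 <= kap) (h0 : 0 <= h).
Hypotheses (p0 : forall j, 0 <= p j) (p1 : \sum_(j < k) p j <= 1).
Hypothesis bD : forall j, mdist b (z j) <= D.
Hypothesis drift_le : forall x, \sum_(j < k) drift b h x (z j) * p j <= kap.

Definition weight w : R := \prod_(j <- w) p j.

Lemma weight_ge0 w : 0 <= weight w.
Proof. by apply: prodr_ge0 => j _; exact: p0. Qed.

(** The index [N] bounds the lengths of all words in play, so that the error made
in each step is the same. *)
Lemma words_moment n : (n <= N)%N ->
  \sum_(w <- words k n)
    weight w * coshR (lam * (n%:R * mdist b (inductive_mean (spell z w) n))) <=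
  expR (n%:R * (2 * (lam * D) ^+ 2 + lam * kap + lam * (2 * N%:R * h))).
Proof.
elim: n => [_|n ih nN].
  rewrite big_seq1 /weight big_nil !mul0r mulr0 mul1r /coshR oppr0 expR0.
  by rewrite -[(1 + 1 : R)]/(2 : R) divff ?pnatr_eq0.
rewrite /= big_allpairs_dep.
rewrite -[in leRHS]natr1 mulrDl mul1r expRD.
apply: le_trans (ler_wpM2r (expR_ge0 _) (ih (ltnW nN))).
rewrite mulr_suml big_seq [leRHS]big_seq; apply: ler_sum => w wW.
have sw := size_words wW.
rewrite big_mkord.
under eq_bigr => j _ do rewrite /weight -cats1 big_cat big_seq1 /= cats1 -mulrA.
rewrite -mulr_sumr -/(weight w) -[leRHS]mulrA ler_wpM2l ?weight_ge0 //.
apply: (@coshR_moment_step _ k p (fun j => drift b h (inductive_mean (spell z w) n) (z j))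
  (fun j => n.+1%:R * mdist b (inductive_mean (spell z (rcons w j)) n.+1))
  lam (n%:R * mdist b (inductive_mean (spell z w) n)) D kap (2 * N%:R * h)) => //.
- by rewrite mulr_ge0 ?mdist_ge0.
- by rewrite !mulr_ge0.
- by move=> j; rewrite drift_norm.
move=> j; rewrite mulr_ge0 ?mdist_ge0 //=.
have := @inductive_mean_drift b z w j h h0; rewrite sw => /le_trans; apply.
by rewrite lerD2l ler_wpM2r // ler_pM2l // ler_nat.
Qed.

(** Markov's inequality for [cosh], with [cosh y >= e^y / 2]. *)
Lemma words_tail n (a : R) : (n <= N)%N ->
  \sum_(w <- words k n |
      a <= n%:R * mdist b (inductive_mean (spell z w) n)) weight w <=
  2 * expR (n%:R * (2 * (lam * D) ^+ 2 + lam * kap + lam * (2 * N%:R * h)) - lam * a).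
Proof.
move=> nN; rewrite expRD mulrA.
apply: (@le_trans _ _ (2 * (\sum_(w <- words k n)
    weight w * coshR (lam * (n%:R * mdist b (inductive_mean (spell z w) n)))) *
    expR (- (lam * a)))); last first.
  by rewrite ler_wpM2r ?expR_ge0 // ler_pM2l // words_moment.
rewrite mulrAC mulr_sumr big_mkcond; apply: ler_sum => w _ /=.
set y := n%:R * _; have c0 := ltW (coshR_gt0 (lam * y)).
case: ifP => [ay|_]; last by rewrite !mulr_ge0 ?expR_ge0 ?weight_ge0.
rewrite mulrCA ler_peMr ?weight_ge0 // expRN mulrAC.
rewrite ler_pdivlMr ?expR_gt0 // mul1r.
have := coshR_ge (lam * y); have : expR (lam * a) <= expR (lam * y).
  by rewrite ler_expR ler_pM2l.
lra.
Qed.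

End moment.

(** * Discretizing the random variables *)

Lemma measure_big_setU_le {R : realType} {d : measure_display}
    {Omega : measurableType d} (P : probability Omega R) (I : Type) (s : seq I) (Q : pred I)
    (F : I -> set Omega) : (forall i, measurable (F i)) ->
  (P (\big[setU/set0]_(i <- s | Q i) F i) <= \sum_(i <- s | Q i) P (F i))%E.
Proof.
move=> mF; elim: s => [|i s ih]; first by rewrite !big_nil measure0.
rewrite !big_cons; case: ifP => // _.
apply: (le_trans (measureU2 _ _ _)) => //; last exact: leeD.
by apply: bigsetU_measurable.
Qed.

Section events.
Context {R : realType} {T : completeMetricType R}.
Context {d : measure_display} {Omega : measurableType d}.
Variables (P : probability Omega R) (Y : nat -> {RV P >-> borel T}).
Variables (S : set T) (z : nat -> T) (e : R).
Hypotheses (indepY : independent_RVs Y) (identY : identically_distributed Y).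
Hypothesis closedS : closed S.

Let nu : probability (borel T) R := distribution P (Y 0%N).

Definition word_event (w : seq nat) : set Omega :=
  \bigcap_(i in [set` iota 0 (size w)]) (Y i @^-1` cell S z e (nth 0%N w i)).

Lemma probability_preimage i (A : set (borel T)) : measurable A ->
  P (Y i @^-1` A) = nu A.
Proof. by move=> mA; exact: (identY i 0%N mA). Qed.

Lemma measurable_preimage i (A : set (borel T)) : measurable A ->
  measurable (Y i @^-1` A).
Proof.
by move=> mA; rewrite -[X in measurable X]setTI; apply: measurable_funPT.
Qed.

Lemma measurable_word_event w : measurable (word_event w).
Proof.
apply: fin_bigcap_measurable => // i _.
by apply: measurable_preimage; exact: measurable_cell.
Qed.

Lemma probability_word_event w :
  P (word_event w) = (weight (mass nu S z e) w)%:E.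
Proof.
have mc j : measurable (cell S z e j) by exact: measurable_cell.
rewrite /word_event indepY ?iota_uniq //.
rewrite /weight -prodEFin [RHS](big_nth 0%N) /index_iota subn0.
apply: eq_bigr => i _; rewrite probability_preimage // fineK //.
exact: fin_num_measure.
Qed.

End events.

Lemma cell_exists {R : realType} {T : completeMetricType R} (S : set T)
    (z : nat -> T) (e : R) k y : S y -> ~ rest S z e k y ->
  exists2 j, (j < k)%N & cell S z e j y.
Proof.
move=> Sy; elim: k => [|k ih] //= nr.
have [ry|/ih[j jk cj]] := pselect (rest S z e k y); last by exists j => //; exact: ltnW.
by exists k => //; split => //; apply: contrapT => nb; apply: nr.
Qed.

Section discretization.
Context {R : realType} {T : completeMetricType R}.
Context {d : measure_display} {Omega : measurableType d}.
Variables (P : probability Omega R) (Y : nat -> {RV P >-> borel T}).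
Variables (S : set T) (z : nat -> T) (e : R).
Hypotheses (treeT : R_tree T).
Hypotheses (indepY : independent_RVs Y) (identY : identically_distributed Y).
Hypothesis closedS : closed S.
Hypothesis fullS : distribution P (Y 0%N) (~` S) = 0%E.

Let nu : probability (borel T) R := distribution P (Y 0%N).

Lemma spell_close n (f : nat -> nat) (y : nat -> T) (b : T) :
  (forall i, (i < n)%N -> ball (z (f i)) e (y i)) ->
  n%:R * (mdist b (inductive_mean y n) - e) <=
  n%:R * mdist b (inductive_mean (spell z [seq f i | i <- iota 0 n]) n).
Proof.
move=> yf; set s := spell z _.
rewrite mulrBr lerBlDr.
apply: (@le_trans _ _ (n%:R * (mdist b (inductive_mean s n) +
    mdist (inductive_mean s n) (inductive_mean y n)))).
  by rewrite ler_wpM2l // metric_triangle.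
rewrite mulrDr lerD2l; apply: le_trans (inductive_mean_lipschitz treeT s y n) _.
rewrite -[n in leRHS]card_ord mulr_natl -sumr_const; apply: ler_sum => i _.
have := yf i (ltn_ord i); rewrite ballEmdist /= => /ltW.
by rewrite /s /spell (nth_map 0%N) ?size_iota // nth_iota.
Qed.

(** Either some variable falls outside all the cells, or the cells of the
variables form a word whose inductive mean is within [e] of the true one.  The
event on the left is covered by a measurable one, which bounds its outer
measure. *)
Lemma discretized_tail (k n : nat) (r : R) (b : T) :
  ((P^*)%mu [set omega : Omega |
     (r <= mdist (inductive_mean (fun i => Y i omega : T) n) b)%R]
   <= (n%:R * rest_mass nu S z e k +
       \sum_(w <- words k n |
         n%:R * (r - e) <= n%:R * mdist b (inductive_mean (spell z w) n))
         weight (mass nu S z e) w)%R%:E)%E.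
Proof.
set E := [set _ | _].
pose good (w : seq nat) :=
  n%:R * (r - e) <= n%:R * mdist b (inductive_mean (spell z w) n).
pose bad i := Y i @^-1` (~` S `|` rest S z e k : set (borel T)).
have mNS : measurable (~` S : set (borel T)) by exact: measurableC (measurable_closed closedS).
have mr : measurable (rest S z e k) by exact: measurable_rest.
have mbad i : measurable (bad i).
  by apply: measurable_preimage; exact: measurableU.
pose B := \big[setU/set0]_(i <- iota 0 n) bad i.
pose G := \big[setU/set0]_(w <- words k n | good w) word_event Y S z e w.
have mB : measurable B by exact: bigsetU_measurable.
have mG : measurable G.
  by apply: bigsetU_measurable => w _; exact: measurable_word_event.
have EBG : E `<=` B `|` G.
  move=> w Ew; apply: contrapT => /not_orP[nB nG]; apply: nG.
  have cells i : exists j, (i < n)%N -> (j < k)%N /\ cell S z e j (Y i w).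
    have [iN|iN] := ltnP i n; last by exists 0%N.
    have nbad : ~ bad i w.
      by move=> bi; apply: nB; rewrite /B -bigcup_seq; exists i; rewrite //= mem_iota.
    have [||j jk cj] := @cell_exists _ _ S z e k (Y i w); last by exists j.
      by apply: contrapT => nS; apply: nbad; left.
    by move=> ri; apply: nbad; right.
  have [f fP] := choice cells.
  rewrite /G -bigcup_seq_cond; exists [seq f i | i <- iota 0 n].
    rewrite /= map_iota_words /=; last by move=> i /fP[].
    apply: (@le_trans _ _ (n%:R * (mdist b (inductive_mean (fun i => Y i w : T) n) - e))).
      by rewrite ler_wpM2l // lerB // metric_sym.
    by apply: spell_close => i /fP[_ []].
  move=> i /=; rewrite size_map size_iota mem_iota /= add0n => iN.
  by rewrite (nth_map 0%N) ?size_iota // nth_iota // add0n; case: (fP i iN).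
apply: le_trans (le_mu_ext P EBG) _.
rewrite measurable_mu_extE; last exact: measurableU.
apply: le_trans (measureU2 _ mB mG) _; rewrite EFinD; apply: leeD.
  apply: le_trans (measure_big_setU_le P (iota 0 n) xpredT mbad) _.
  apply: (@le_trans _ _ (\sum_(i <- iota 0 n) (rest_mass nu S z e k)%:E)%E).
    apply: lee_sum => i _; rewrite /bad probability_preimage //; last exact: measurableU.
    have nuNS : nu (~` S) = 0%E := fullS.
    have : (nu (~` S `|` rest S z e k) <= nu (~` S) + nu (rest S z e k))%E.
      exact: measureU2.
    by rewrite nuNS add0e /rest_mass fineK // fin_num_measure.
  by rewrite sumEFin lee_fin big_const_seq count_predT size_iota iter_addr_0 mulr_natl.
apply: le_trans (measure_big_setU_le P (words k n) good
  (measurable_word_event Y z e closedS)) _.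
by rewrite -sumEFin; apply: lee_sum => w _; rewrite probability_word_event.
Qed.

End discretization.

(** * The tail bound *)

Section support.
Context {R : realType} {T : completeMetricType R}.
Variables (nu : probability (borel T) R) (S : set T).

Lemma support_nonempty : nu (~` S) = 0%E -> exists x, S x.
Proof.
move=> nuS; apply: contrapT => /forallNP S0.
move: nuS; rewrite (_ : ~` S = setT); last by apply/seteqP; split => x // _; exact: S0.
by move/eqP; rewrite probability_setT onee_eq0.
Qed.

Lemma diameter_mdist_le (D : R) : diameter S = D%:E ->
  forall x y, S x -> S y -> mdist x y <= D.
Proof.
move=> dS x y Sx Sy; rewrite -lee_fin -dS; apply: ereal_sup_ubound.
by exists (x, y).
Qed.

End support.

Section tail.
Context {R : realType} {T : completeMetricType R}.
Context {d : measure_display} {Omega : measurableType d}.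
Variables (P : probability Omega R) (Y : nat -> {RV P >-> borel T}).
Variables (S : set T) (D : R).
Hypotheses (treeT : R_tree T).
Hypotheses (indepY : independent_RVs Y) (identY : identically_distributed Y).

Let nu : probability (borel T) R := distribution P (Y 0%N).
Hypotheses (suppS : is_support nu S) (diamS : diameter S = D%:E).

Let b := barycenter nu.

Definition deviation (n : nat) (r : R) : set Omega := [set omega : Omega |
  (r <= mdist (inductive_mean (fun i => Y i omega : T) n) b)%R].

(** The parameter [dl] serves as radius of the cells, as mass left uncovered, and
as half of the threshold for the sides. *)
Lemma deviation_small_errors (n : nat) (r lam dl : R) : 0 < lam -> 0 < dl ->
  ((P^*)%mu (deviation n r) <= (n%:R * dl +
     2 * expR (n%:R * (2 * (lam * D) ^+ 2 - lam * r) +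
       n%:R * lam * dl * (5 / 2 + D + 4 * n%:R)))%:E)%E.
Proof.
move=> lam0 dl0; have [closedS fullS _] := suppS.
have [z0 Sz0] := support_nonempty fullS.
have dS := diameter_mdist_le diamS.
have D0 : 0 <= D := diam_ge0 Sz0 dS.
have [z [k [Sz rest_dl]]] := finite_net Sz0 suppS dl0 dl0.
apply: le_trans (discretized_tail z dl treeT indepY identY closedS fullS k n r b) _.
rewrite lee_fin; apply: lerD; first by rewrite ler_wpM2l.
pose kap := dl / 2 + dl + D * dl.
have kap0 : 0 <= kap by rewrite !addr_ge0 ?mulr_ge0 // ltW.
have h0 : 0 <= 2 * dl by rewrite mulr_ge0 // ltW.
have p0 j : 0 <= mass nu S z dl j by exact: mass_ge0.
have p1 : \sum_(j < k) mass nu S z dl j <= 1.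
  have := sum_mass closedS fullS z dl k; have := rest_mass_ge0 nu S z dl k.
  by rewrite /nu; lra.
have bD j : mdist b (z j) <= D.
  exact: (barycenter_mdist_le treeT closedS fullS Sz0 dS).
have drift_le x : \sum_(j < k) drift b (2 * dl) x (z j) * mass nu S z dl j <= kap.
  apply: le_trans (barycenter_drift_le treeT closedS fullS Sz0 dS k x Sz dl0 _) _.
    by rewrite lexx ltW.
  by rewrite /kap lerD2l ler_wpM2l.
apply: le_trans (words_tail treeT lam0 kap0 h0 p0 p1 bD drift_le _ (leqnn n)) _.
rewrite ler_pM2l // ler_expR /kap le_eqVlt; apply/orP; left; apply/eqP.
by field.
Qed.

(** When the support is a point, all the variables almost surely coincide with
[b]. *)
Lemma deviation_diam0 (n : nat) (r : R) : D = 0 -> (0 < n)%N -> 0 < r ->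
  (P^*)%mu (deviation n r) = 0%E.
Proof.
move=> D0 n0 r0; have [closedS fullS _] := suppS.
have [z0 Sz0] := support_nonempty fullS.
have dS := diameter_mdist_le diamS.
have mNS : measurable (~` S : set (borel T)) by exact: measurableC (measurable_closed closedS).
pose bad i := Y i @^-1` (~` S : set (borel T)).
have mbad i : measurable (bad i) by exact: measurable_preimage.
have sub : deviation n r `<=` \big[setU/set0]_(i <- iota 0 n) bad i.
  move=> w; rewrite /deviation /= => rw; apply: contrapT => nbad.
  have SY i : (i < n)%N -> S (Y i w).
    move=> iN; apply: contrapT => nS; apply: nbad; rewrite -bigcup_seq.
    by exists i; rewrite //= mem_iota.
  have zero m : (m <= n)%N ->
      m%:R * mdist b (inductive_mean (fun i => Y i w : T) m) <= 0.
    elim: m => [|m ih] mn; first by rewrite mul0r.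
    apply: le_trans (inductive_mean_growth treeT _ _ b) _.
    rewrite -[leRHS]addr0; apply: lerD; first by apply: ih; exact: ltnW.
    by rewrite -D0; apply: (barycenter_mdist_le treeT closedS fullS Sz0 dS); exact: SY.
  have := zero n (leqnn n); rewrite metric_sym leNgt => /negP; apply.
  by rewrite mulr_gt0 ?ltr0n // (lt_le_trans r0).
apply/eqP; rewrite eq_le; apply/andP; split; last first.
  by apply: mu_ext_ge0 => A; exact: measure_ge0.
apply: le_trans (le_mu_ext P sub) _.
rewrite measurable_mu_extE; last by apply: bigsetU_measurable.
apply: le_trans (measure_big_setU_le P (iota 0 n) xpredT mbad) _.
rewrite big1 // => i _; rewrite /bad probability_preimage //.
Qed.

(** The choice [lam = r / (4 D^2)] minimizes [2 (lam D)^2 - lam r], with value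
[- r^2 / (8 D^2)].  The error terms are made at most [4 / 75] in the exponent and
half of the claimed bound outside of it. *)
Lemma deviation_tail (n : nat) (r : R) : 0 < D -> 0 < r ->
  ((P^*)%mu (deviation n r) <=
   (4 * expR (4 / 75) * expR (- (n%:R * r ^+ 2 / (150 * D ^+ 2))))%:E)%E.
Proof.
move=> D0 r0; pose lam := r / (4 * D ^+ 2).
have DD : 0 < D ^+ 2 by rewrite exprn_gt0.
have lam0 : 0 < lam by rewrite divr_gt0 // mulr_gt0.
pose bound := expR (4 / 75) * expR (- (n%:R * r ^+ 2 / (150 * D ^+ 2))) : R.
have bound0 : 0 < bound by rewrite mulr_gt0 // expR_gt0.
pose C := n%:R * lam * (5 / 2 + D + 4 * n%:R).
have C0 : 0 <= C.
  have q0 : 0 <= 5 / 2 + D + 4 * n%:R by rewrite !addr_ge0 ?mulr_ge0 // ltW.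
  exact: mulr_ge0 (mulr_ge0 (ler0n _ _) (ltW lam0)) q0.
(* Adding 1 to the denominators avoids dividing by 0. *)
pose dl := Num.min (bound / (n%:R + 1)) (4 / 75 / (C + 1)).
have dl0 : 0 < dl.
  by rewrite lt_min !divr_gt0 // ltr_wpDl.
have dl1 : n%:R * dl <= 2 * bound.
  have : dl * (n%:R + 1) <= bound.
    by rewrite -ler_pdivlMr ?ge_min ?lexx // ltr_wpDl.
  by rewrite mulrDr mulr1; lra.
have dl2 : C * dl <= 4 / 75.
  have : dl * (C + 1) <= 4 / 75.
    by rewrite -ler_pdivlMr ?ge_min ?lexx ?orbT // ltr_wpDl.
  by rewrite mulrDr mulr1; lra.
apply: le_trans (deviation_small_errors n r lam0 dl0) _; rewrite lee_fin.
rewrite [leRHS](_ : _ = 2 * bound + 2 * bound); last by rewrite /bound; ring.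
apply: lerD => //; rewrite ler_pM2l // /bound -expRD ler_expR addrC lerD //.
  by rewrite mulrAC -/C.
have -> : n%:R * (2 * (lam * D) ^+ 2 - lam * r) = - (n%:R * r ^+ 2 / (8 * D ^+ 2)).
  by rewrite /lam; field; rewrite gt_eqF.
rewrite lerN2; apply: ler_wpM2l; first by rewrite mulr_ge0 ?sqr_ge0.
rewrite lef_pV2 ?posrE ?mulr_gt0 //.
by rewrite ler_pM2r // ler_nat.
Qed.

End tail.

Unset Implicit Arguments.

(* Y i is the variable Y_(i+1).
   P^* is the outer measure of P, equal to P on measurable sets: Borel
   measurability of each Y i does not make omega |-> S_n(omega) measurable when
   T is not separable.
   The quotient is in \bar R, where 1 / 0 = +oo: for D = 0 the bound is 0. *)
Theorem theorem1p1 (R : realType) (T : completeMetricType R)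
    (d : measure_display) (Omega : measurableType d) (P : probability Omega R)
    (Y : nat -> {RV P >-> borel T}) (S : set T) (D : R) :
  R_tree T ->
  independent_RVs Y ->
  identically_distributed Y ->
  is_support (distribution P (Y 0%N)) S ->
  diameter S = D%:E ->
  forall (n : nat) (r : R), (0 < n)%N -> 0 < r ->
  ((P^*)%mu [set omega : Omega |
     (r <= mdist (inductive_mean (fun i => Y i omega : T) n)
                 (expectation_in (Y 0%N)))%R]
   <= (4 * expR (4 / 75))%:E *
      expeR (- ((n%:R * r ^+ 2)%:E / (150 * D ^+ 2)%:E)))%E.
Proof.
move=> treeT indepY identY suppS diamS n r n0 r0.
have [D0|D0] := eqVneq D 0.
  rewrite (_ : (P^*)%mu _ = 0%E); last exact: (deviation_diam0 treeT identY suppS diamS D0 n0 r0).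
  by rewrite mule_ge0 ?expeR_ge0 // lee_fin mulr_ge0 // expR_ge0.
have [_ fullS _] := suppS; have [z0 Sz0] := support_nonempty fullS.
have Dgt0 : 0 < D.
  by rewrite lt_neqAle eq_sym D0 (diam_ge0 Sz0 (diameter_mdist_le diamS)).
have E0 : 150 * D ^+ 2 != 0 by rewrite mulf_neq0 ?pnatr_eq0 // expf_neq0.
rewrite inver (negbTE E0) -[expeR _]/((expR (- (n%:R * r ^+ 2 / (150 * D ^+ 2))))%:E).
rewrite -EFinM.
exact: (deviation_tail treeT indepY identY suppS diamS n Dgt0 r0).
Qed.
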